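(* The following hold. (1) There is an interval filament graph which is not a polygon-circle graph. (2) There is a grounded L-graph which is not an interval filament graph. (3) There is a monotone L-graph which is not an interval filament graph. (4) There is a polygon-circle graph which is not an outer-$1$-string graph.
   Context: Graphs are finite. The intersection graph of a finite family of subsets of $\mathbb{R}^2$ has the members of the family as vertices, two distinct members being adjacent if and only if they have non-empty intersection; each class below is considered up to graph isomorphism. Interval filament graphs: intersection graphs of interval filaments, where an interval filament is (the graph in the plane of) a continuous non-negative function defined on a closed interval of $\mathbb{R}$ attaining value zero at both endpoints of the interval. Polygon-circle graphs: intersection graphs of polygons (convex regions, chords being allowed as degenerate polygons) inscribed in a common circle. Equivalently, they are the intersection graphs of circle filaments, where a circle filament is an interval filament consisting of some number of consecutive, externally touching upper semicircles, each with both ends on the $x$-axis. L-shapes: an L-shape consists of a vertical segment and a horizontal segment that meet at their uppermost and leftmost endpoints respectively (an upside-down ''L''); the common point is its bend. An L-shape is grounded if its lowermost point is on the $x$-axis. Grounded L-graphs are the intersection graphs of families of grounded L-shapes. Monotone L-graphs (also called max point-tolerance graphs) are the intersection graphs of families of L-shapes all of whose bends belong to a common upward-sloping line. Outer-$1$-string graphs: a string is a bounded continuous curve in the plane; a grounded string is a string one end of which lies on a fixed horizontal line (the grounding line) and whose remaining points lie strictly above that line. A family of strings is simple if any two of them intersect in at most one point. Outer-$1$-string graphs are the intersection graphs of simple families of grounded strings (all with the same grounding line). *)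

(* Defs.v *)
From mathcomp Require Import all_boot all_order all_algebra.
From mathcomp Require Import all_classical all_reals all_analysis.

Set Implicit Arguments.
Unset Strict Implicit.
Unset Printing Implicit Defensive.

Import Order.TTheory GRing.Theory Num.Theory.
Import numFieldNormedType.Exports.

Local Open Scope classical_set_scope.
Local Open Scope ring_scope.

Record sgraph := SGraph {
  vertex :> finType;
  adj : rel vertex;
  adj_sym : symmetric adj;
  adj_irrefl : irreflexive adj }.

(* The family is indexed by the vertices of [G], so being an intersection graph
   is automatically invariant under isomorphism.  Distinct indices count as
   distinct members, even when they carry the same set. *)
Definition intersection_graph (G : sgraph) (T : Type) (F : G -> set T) : Prop :=
  forall u v : G, u != v -> (adj u v <-> F u `&` F v !=set0).

Section plane.
Variable R : realType.
Local Notation plane := (R * R)%type.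

Definition interval_filament (A : set plane) : Prop :=
  exists (a b : R) (f : R -> R),
    [/\ a < b,
        {within `[a, b], continuous f},
        (forall x, x \in `[a, b] -> 0 <= f x),
        f a = 0 /\ f b = 0 &
        A = [set (x, f x) | x in `[a, b]]].

Definition interval_filament_graph (G : sgraph) : Prop :=
  exists F : G -> set plane,
    (forall v, interval_filament (F v)) /\ intersection_graph F.

(* The norm carried by [R * R] is the sup norm, so Euclidean circles are given
   by their equation. *)
Definition circle (c : plane) (r : R) : set plane :=
  [set p | (p.1 - c.1) ^+ 2 + (p.2 - c.2) ^+ 2 = r ^+ 2].

Definition convex_hull (A : set plane) : set plane :=
  smallest (@convex_set R plane) A.

(* [s] lists the corners; two corners give a chord. *)
Definition inscribed_polygon (c : plane) (r : R) (A : set plane) : Prop :=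
  exists s : seq plane,
    [/\ uniq s, (2 <= size s)%N,
        [set` s] `<=` circle c r &
        A = convex_hull [set` s]].

Definition polygon_circle_graph (G : sgraph) : Prop :=
  exists (c : plane) (r : R) (F : G -> set plane),
    [/\ 0 < r, (forall v, inscribed_polygon c r (F v)) & intersection_graph F].

Record Lshape := LShape {
  bend : plane;
  low_end : R;
  right_end : R;
  low_end_lt : low_end < bend.2;
  right_end_gt : bend.1 < right_end }.

Definition Lshape_set (L : Lshape) : set plane :=
  [set ((bend L).1, y) | y in `[low_end L, (bend L).2]] `|`
  [set (x, (bend L).2) | x in `[(bend L).1, right_end L]].

Definition grounded_L (L : Lshape) : Prop := low_end L = 0.

Definition grounded_L_graph (G : sgraph) : Prop :=
  exists L : G -> Lshape,
    (forall v, grounded_L (L v)) /\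
    intersection_graph (fun v => Lshape_set (L v)).

Definition monotone_L_graph (G : sgraph) : Prop :=
  exists (L : G -> Lshape) (m q : R),
    [/\ 0 < m,
        (forall v, (bend (L v)).2 = m * (bend (L v)).1 + q) &
        intersection_graph (fun v => Lshape_set (L v))].

(* A string is the trace of a curve parametrized by [0, 1], which makes it
   bounded.  The curve is allowed to be self-intersecting. *)
Definition grounded_string (l : R) (A : set plane) : Prop :=
  exists gamma : R -> plane,
    [/\ {within `[0, 1], continuous gamma},
        (gamma 0).2 = l,
        (forall t, t \in `]0, 1] -> l < (gamma t).2) &
        A = gamma @` `[0, 1]].

Definition simple_family (I : eqType) (F : I -> set plane) : Prop :=
  forall i j : I, i != j -> is_subset1 (F i `&` F j).

Definition outer_1_string_graph (G : sgraph) : Prop :=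
  exists (l : R) (F : G -> set plane),
    [/\ (forall v, grounded_string l (F v)),
        simple_family F & intersection_graph F].

End plane.

(* Main.v *)
Require Import Defs.
From mathcomp Require Import all_boot all_order all_algebra.
From mathcomp Require Import all_classical all_reals all_analysis.
From mathcomp Require Import zify ring lra.

(** Each of the graphs below gets its first kind of representation by explicit
    coordinates; the work is to refuse it the second kind.

    Of two disjoint filaments, either they lie side by side or one lies under
    the other, and whatever meets the lower filament without meeting the upper
    one stays under the upper one ([disjoint_filaments], [under_meets]). The
    graph [linked_squares] consists of two connected copies of a gadget around
    a four-cycle. If a filament lies over another one of its own four-cycle,
    it lies over the whole other copy; this cannot happen in both copies, as
    nothing lies under itself. In one of the copies both nonadjacent pairs of
    the four-cycle hence lie side by side, so that the four-cycle is an
    interval graph, which it is not. L-shapes do not enclose regions in this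
    way, and the graph is both a grounded and a monotone L-graph.

    The interval filament graph that is not a polygon-circle graph is the
    prism, the complement of the six-cycle. In a stereographic parameter,
    polygons inscribed in a circle become finite sets of reals, and two
    polygons are disjoint exactly if one of these sets avoids the interval
    spanned by the other ([separated_disjoint]). It follows that a vertex of
    one triangle and the two vertices of the other triangle that it does not
    see are separated by a single interval ([avoids_same_gap]), and the
    possible positions of the three intervals that arise in this way are
    excluded one by one ([no_prism_blocks]). Filaments have more freedom,
    since they may come down just far enough to meet one filament that lies
    below, without reaching the ground.

    The last graph must have no outer-1-string representation, where a string
    may even intersect itself. What remains of its being a curve is that it is
    a continuum in which each point [q] can be reached from each other point
    through points that are reached without passing through [q]
    ([grounded_string_reaches]). Continua with alternating feet on the
    grounding line meet ([alternating_continua_meet], proved by counting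
    crossings modulo 2 on a fine grid). The vertices of the graph are all
    polygons spanned by up to four of twelve blocks of corners on a circle,
    and the polygon of a single block serves as a pole. In whatever order
    twelve disjoint poles stand on the line, there are polygons [u] and [v]
    whose strings are forced to cross at the first four poles and again at
    four later poles, with two disjoint strings separating these two places,
    at least one of which avoids the only common point of [u] and [v]. Cutting
    [u] at this point must disconnect the poles at both places, and then the
    string that avoids the point has to meet [u] twice
    ([no_alternating_strings]). *)

Set Implicit Arguments.
Unset Strict Implicit.
Unset Printing Implicit Defensive.

Import Order.TTheory GRing.Theory Num.Theory.
Import numFieldNormedType.Exports.

Local Open Scope classical_set_scope.
Local Open Scope ring_scope.

(** * Disjoint interval filaments *)

Section filaments.
Variable R : realType.

Record filament := Filament {
  lend : R;
  rend : R;
  height : R -> R;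
  lend_lt_rend : lend < rend;
  height_continuous : {within `[lend, rend], continuous height};
  height_lend : height lend = 0;
  height_rend : height rend = 0;
  height_ge0 : forall x, x \in `[lend, rend] -> 0 <= height x }.

Definition trace (A : filament) : set (R * R) :=
  [set (x, height A x) | x in `[lend A, rend A]].

Definition meets (A B : filament) : Prop :=
  exists x, [/\ x \in `[lend A, rend A], x \in `[lend B, rend B] &
                height A x = height B x].

Lemma traceP (A : set (R * R)) :
  interval_filament A -> exists F : filament, A = trace F.
Proof.
move=> [a [b [f [ab cf f0 [fa fb] ->]]]].
by exists (Filament ab cf fa fb f0).
Qed.

Lemma trace_filament (A : filament) : interval_filament (trace A).
Proof.
by exists (lend A), (rend A), (height A); case: A => /= *; split.
Qed.

Lemma trace_meets (A B : filament) :
  trace A `&` trace B !=set0 <-> meets A B.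
Proof.
split=> [[p [[x xA <-] [y yB]]] [xy hxy]|[x [xA xB hAB]]].
  by subst y; exists x; split.
exists (x, height A x); split; first by exists x.
by exists x => //; rewrite hAB.
Qed.

Definition under (A B : filament) : Prop :=
  [/\ lend B < lend A, rend A < rend B &
      forall x, x \in `[lend A, rend A] -> height A x < height B x].

Lemma meetsC (A B : filament) : meets A B -> meets B A.
Proof. by case=> x [xA xB hAB]; exists x; split. Qed.

Lemma under_trans (A B C : filament) : under A B -> under B C -> under A C.
Proof.
move=> [lBA rAB hAB] [lCB rBC hBC]; split.
- exact: lt_trans lCB lBA.
- exact: lt_trans rAB rBC.
- move=> x xA; apply: lt_trans (hAB x xA) (hBC x _).
  by move: xA; rewrite !in_itv/=; lra.
Qed.

Lemma under_irrefl (A : filament) : ~ under A A.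
Proof. by case; rewrite ltxx. Qed.

(** On the common part of two overlapping intervals the difference of the
    heights is continuous and never zero, so it has a constant sign; at an end
    of the common part one of the two heights vanishes, so that end must belong
    to the lower filament, and to it alone. *)
Lemma disjoint_filaments (A B : filament) : ~ meets A B ->
  [\/ under A B, under B A, rend A < lend B | rend B < lend A].
Proof.
move=> nAB.
have /orP[?|lr1] : (rend A < lend B) || (lend B <= rend A) by case: ltP.
  by constructor 3.
have /orP[?|lr2] : (rend B < lend A) || (lend A <= rend B) by case: ltP.
  by constructor 4.
wlog : A B nAB lr1 lr2 /
    exists x, [/\ x \in `[lend A, rend A], x \in `[lend B, rend B] &
                  height A x < height B x].
  move=> H.
  have lA := lend_lt_rend A; have lB := lend_lt_rend B.
  have [x [xA xB]] : exists x, x \in `[lend A, rend A] /\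
                               x \in `[lend B, rend B].
    by have [h|h] := leP (lend A) (lend B); [exists (lend B)|exists (lend A)];
      rewrite !in_itv/=; split; lra.
  have [h|h|h] := ltgtP (height A x) (height B x).
  - by apply: H => //; exists x; split.
  - have : [\/ under B A, under A B, rend B < lend A | rend A < lend B].
      apply: H => //; first by move=> /meetsC.
      by exists x; split.
    by case=> ?; [constructor 2|constructor 1|constructor 4|constructor 3].
  - by case: nAB; exists x; split.
case=> x0 [x0A x0B hx0]; constructor 1.
have below x : x \in `[lend A, rend A] -> x \in `[lend B, rend B] ->
    height A x < height B x.
  move=> xA xB; rewrite ltNge; apply/negP => hx.
  have key a b : a <= b -> a \in `[lend A, rend A] -> a \in `[lend B, rend B] ->
      b \in `[lend A, rend A] -> b \in `[lend B, rend B] ->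
      Num.min ((height A - height B) a) ((height A - height B) b) <= 0
        <= Num.max ((height A - height B) a) ((height A - height B) b) -> False.
    move=> ab aA aB bA bB h0.
    have sub F : a \in `[lend F, rend F] -> b \in `[lend F, rend F] ->
        `[a, b] `<=` `[lend F, rend F].
      by move=> aF bF z; move: aF bF; rewrite /= !in_itv/=; lra.
    have cAB : {within `[a, b], continuous (height A - height B)}.
      apply: within_continuousB.
        exact: continuous_subspaceW (sub A aA bA) (@height_continuous A).
      exact: continuous_subspaceW (sub B aB bB) (@height_continuous B).
    have [c cab hc] := IVT ab cAB h0.
    apply: nAB; exists c; split; [exact: (sub A)|exact: (sub B)|].
    by apply/eqP; rewrite -subr_eq0; apply/eqP.
  have [xx0|x0x] := leP x x0.
    apply: (key x x0) => //; rewrite ge_min le_max.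
    by rewrite !fctE !subr_ge0 !subr_le0 hx (ltW hx0) orbT.
  apply: (key x0 x) => //; first exact: ltW.
  rewrite ge_min le_max.
  by rewrite !fctE !subr_ge0 !subr_le0 hx (ltW hx0) orbT.
have lA := lend_lt_rend A; have lB := lend_lt_rend B.
have lBA : lend B < lend A.
  rewrite ltNge; apply/negP => lAB.
  have lBAi : lend B \in `[lend A, rend A] by rewrite in_itv/=; lra.
  suff: height A (lend B) < 0 by rewrite ltNge height_ge0.
  by rewrite -(height_lend B) below// in_itv/=; lra.
have rAB : rend A < rend B.
  rewrite ltNge; apply/negP => rBA.
  have rBAi : rend B \in `[lend A, rend A] by rewrite in_itv/=; lra.
  suff: height A (rend B) < 0 by rewrite ltNge height_ge0.
  by rewrite -(height_rend B) below// in_itv/=; lra.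
by split=> // x xA; apply: below => //; move: xA; rewrite !in_itv/=; lra.
Qed.

(** The region under [B] is bounded by [B] and by the ground line, which no
    filament crosses: a filament that meets something in that region can leave
    it only by meeting [B]. *)
Lemma under_meets (A B C : filament) :
  under A B -> meets C A -> ~ meets C B -> under C B.
Proof.
move=> [lBA rAB hAB] [x [xC xA hCA]] /disjoint_filaments nCB.
have hx := hAB x xA.
have xB : lend B < x < rend B by move: xA; rewrite in_itv/=; lra.
case: nCB => [//|[_ _ hBC]|h|h].
- have : height B x < height C x by apply: hBC; rewrite in_itv/=; lra.
  by rewrite hCA; lra.
- by move: xC; rewrite in_itv/=; lra.
- by move: xC; rewrite in_itv/=; lra.
Qed.

End filaments.

Lemma filament_graphP (R : realType) (G : sgraph) :
  interval_filament_graph R G <->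
  exists F : G -> filament R,
    forall u v, u != v -> adj u v <-> meets (F u) (F v).
Proof.
split=> [[F [Ffil FG]]|[F FG]]; last first.
  exists (fun v => trace (F v)).
  split=> [v|u v uv]; first exact: trace_filament.
  by rewrite FG// trace_meets.
have [F' F'E] := choice (fun v => traceP (Ffil v)).
by exists F' => u v uv; rewrite FG// !F'E trace_meets.
Qed.

(** * A graph of L-shapes without filament representation *)

(** The four-cycle is [0 1 2 3], and [6] is the hub through which the copies
    communicate.  The vertices [4] and [5] give access to it: either end of a
    nonadjacent pair of the cycle reaches the hub without passing next to the
    other end. *)
Definition gadget_edges : seq (nat * nat) :=
  [:: (0, 1); (1, 2); (2, 3); (0, 3);
      (0, 4); (1, 4); (2, 5); (3, 5); (4, 6); (5, 6)]%N.

Definition linked_squares_adj : rel (bool * 'I_7) := fun u v =>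
  if u.1 == v.1 then
    ((u.2 : nat, v.2 : nat) \in gadget_edges) ||
    ((v.2 : nat, u.2 : nat) \in gadget_edges)
  else (u.2 == 6 :> nat) && (v.2 == 6 :> nat).

Lemma linked_squares_sym : symmetric linked_squares_adj.
Proof.
by move=> u v; rewrite /linked_squares_adj eq_sym orbC andbC.
Qed.

Lemma linked_squares_irrefl : irreflexive linked_squares_adj.
Proof.
move=> [b i]; rewrite /linked_squares_adj eqxx orbb /=.
by case: i; do 7 case=> //.
Qed.

Definition linked_squares : sgraph :=
  SGraph linked_squares_sym linked_squares_irrefl.

Section representation.
Variables (R : realType) (G : sgraph) (F : G -> filament R).
Hypothesis FG : forall u v, u != v -> adj u v <-> meets (F u) (F v).

Lemma under_path (u x : G) (s : seq G) :
  path (@adj G) u s -> all (fun w => (w != x) && ~~ adj w x) s ->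
  under (F u) (F x) -> under (F (last u s)) (F x).
Proof.
elim: s u => //= w s IH u /andP[uw ws] /andP[/andP[wx nwx] sx] ux.
apply: IH => //; apply: under_meets ux _ _.
  apply/FG; last by rewrite adj_sym.
  by apply: contraTneq uw => ->; rewrite adj_irrefl.
by move/(FG wx); rewrite (negbTE nwx).
Qed.
End representation.

Local Notation "'o' k" := (@Ordinal 7 k isT) (at level 10).

Section linked_squares_filaments.
Variables (R : realType) (F : linked_squares -> filament R).
Hypothesis FG : forall u v, u != v -> adj u v <-> meets (F u) (F v).

Let handle (i : 'I_7) : 'I_7 := if (i < 2)%N then o 4 else o 5.

(** Nothing on the way from [i] to the other copy meets the filament of [j], so
    all of the way stays under that filament. *)
Lemma other_copy_under (b : bool) (i j m : 'I_7) :
  (i < 4)%N -> (j < 4)%N -> i + 2 = j %[mod 4] ->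
  under (F (b, i)) (F (b, j)) -> under (F (~~ b, m)) (F (b, j)).
Proof.
move=> i4 j4 ij.
pose s := [:: (b, handle i); (b, o 6)] ++
          (if (m < 6)%N then [:: (~~ b, o 6)] else [::]) ++
          (if (m < 4)%N then [:: (~~ b, handle m)] else [::]) ++ [:: (~~ b, m)].
have -> : F (~~ b, m) = F (last (b, i) s) by rewrite /s !last_cat.
apply: (under_path FG) => //; rewrite {}/s.
  by case: b i j m i4 j4 ij => -[[|[|[|[|?]]]] Hi] [j Hj]
       [[|[|[|[|[|[|[|?]]]]]]] Hm].
by case: b i j m i4 j4 ij => -[[|[|[|[|?]]]] Hi] [[|[|[|[|?]]]] Hj]
     [[|[|[|[|[|[|[|?]]]]]]] Hm].
Qed.

Lemma linked_squares_no_filaments : False.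
Proof.
pose enclosing b j := forall m, under (F (~~ b, m)) (F (b, j)).
have [b nb] : exists b, forall j, ~ enclosing b j.
  apply: contrapT => /forallNP H.
  have /existsNP[j /contrapT jt] := H true.
  have /existsNP[k /contrapT kf] := H false.
  exact: under_irrefl (under_trans (jt k) (kf j)).
have adjE (i j : 'I_7) : @adj linked_squares (b, i) (b, j) =
    (((i : nat, j : nat) \in gadget_edges) ||
     ((j : nat, i : nat) \in gadget_edges)).
  by rewrite /= /linked_squares_adj eqxx.
have adjF (i j : 'I_7) : ((i : nat, j : nat) \in gadget_edges) ->
    meets (F (b, i)) (F (b, j)).
  move=> ijE; have ij : @adj linked_squares (b, i) (b, j) by rewrite adjE ijE.
  by apply/FG => //; apply: contraTneq ij => ->; rewrite adj_irrefl.
have apart (i j : 'I_7) : (i < 4)%N -> (j < 4)%N -> i + 2 = j %[mod 4] ->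
    rend (F (b, i)) < lend (F (b, j)) \/ rend (F (b, j)) < lend (F (b, i)).
  move=> i4 j4 ij.
  have [nij ne] : ~~ @adj linked_squares (b, i) (b, j) /\ i != j.
    by rewrite adjE; move: i j i4 j4 ij =>
      [[|[|[|[|?]]]] Hi] [[|[|[|[|?]]]] Hj].
  have nm : ~ meets (F (b, i)) (F (b, j)).
    have ne2 : ((b, i) : linked_squares) != (b, j) by rewrite xpair_eqE eqxx.
    by move/(FG ne2); rewrite (negbTE nij).
  have ji : j + 2 = i %[mod 4].
    by move: i j i4 j4 ij {nij ne nm} =>
      [[|[|[|[|?]]]] Hi] [[|[|[|[|?]]]] Hj].
  have [u|u|lt|lt] := disjoint_filaments nm; [| |by left|by right].
  - by case: (nb j) => m; apply: other_copy_under u.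
  - by case: (nb i) => m; apply: other_copy_under u.
(* The left-right order of one nonadjacent pair fixes that of the other. *)
have [x01 []] := adjF (o 0) (o 1) isT.
have [x12 []] := adjF (o 1) (o 2) isT.
have [x23 []] := adjF (o 2) (o 3) isT.
have [x03 []] := adjF (o 0) (o 3) isT.
rewrite !in_itv/=.
by case: (apart (o 0) (o 2)) => //; case: (apart (o 1) (o 3)) => //; lra.
Qed.
End linked_squares_filaments.

Lemma linked_squares_not_filament (R : realType) :
  ~ interval_filament_graph R linked_squares.
Proof. by move/filament_graphP => [F /linked_squares_no_filaments]. Qed.

(** * Its representations by L-shapes *)

Section Lshapes.
Variable R : realType.

(** With distinct abscissas only the horizontal part of the left shape can meet
    the right one, and if it meets the horizontal part of the latter it also
    meets the bend, hence the vertical part. *)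
Lemma Lshapes_meet (L M : Lshape R) : (bend L).1 < (bend M).1 ->
  (Lshape_set L `&` Lshape_set M !=set0) <->
  [&& low_end M <= (bend L).2, (bend L).2 <= (bend M).2 &
      (bend M).1 <= right_end L].
Proof.
move=> LM; have := low_end_lt M; have := right_end_gt L => rL lM; split.
  case=> -[a b] [[[y yL [? ?]]|[x xL [? ?]]] [[y' yM [? ?]]|[x' xM [? ?]]]];
    subst a b.
  - by subst; lra.
  - by subst; move: xM; rewrite /= in_itv/=; lra.
  - by subst; move: xL yM; rewrite /= !in_itv/=; lra.
  - by subst; move: xL xM; rewrite /= !in_itv/=; lra.
move=> /and3P[h1 h2 h3]; exists ((bend M).1, (bend L).2); split.
  by right; exists (bend M).1; rewrite //= in_itv/=; lra.
by left; exists (bend L).2; rewrite //= in_itv/=; lra.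
Qed.

Section coordinates.
Variables (G : sgraph) (x h low r : G -> nat).
Hypothesis low_h : forall v, (low v < h v)%N.
Hypothesis x_r : forall v, (x v < r v)%N.

Definition coordinate_Lshape (v : G) : Lshape R :=
  @LShape R ((x v)%:R, (h v)%:R) (low v)%:R (r v)%:R
    (etrans (ltr_nat R _ _) (low_h v)) (etrans (ltr_nat R _ _) (x_r v)).

Lemma coordinate_Lshape_graph :
  injective x ->
  (forall u v, (x u < x v)%N ->
     adj u v = [&& low v <= h u, h u <= h v & x v <= r u]%N) ->
  intersection_graph (fun v => Lshape_set (coordinate_Lshape v)).
Proof.
move=> xinj adjE u v uv.
wlog lt : u v uv / (x u < x v)%N.
  move=> H; case: (ltngtP (x u) (x v)) => [lt|lt|/xinj/eqP].
  - exact: H.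
  - by rewrite adj_sym setIC; apply: H; rewrite // eq_sym.
  - by rewrite (negbTE uv).
rewrite (Lshapes_meet (L := coordinate_Lshape u)) /= ?ltr_nat//.
by rewrite !ler_nat adjE.
Qed.
End coordinates.

Let entry (s : seq nat) (v : linked_squares) : nat := nth 0%N s v.2.

Lemma coordinates_inj (s : seq nat) (d : nat) :
  uniq s -> size s = 7%N -> all (fun k => k < d)%N s ->
  injective (fun v => entry s v + d * v.1)%N.
Proof.
move=> s_uniq s7 sd [b i] [c j] /=.
have sE (k : 'I_7) : (nth 0%N s k < d)%N.
  by apply: (allP sd); rewrite mem_nth ?s7.
have [si sj] := (sE i, sE j).
rewrite /entry /= => E.
have bc : b = c by move: si sj E; case: (b); case: (c) => //=; nia.
congr (_, _) => //; apply: val_inj; apply/eqP.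
rewrite -(nth_uniq 0%N _ _ s_uniq) ?s7 ?ltn_ord//.
by move: E; rewrite bc => /addIn ->.
Qed.

(** In the order from left to right the copies read [4 6 0 2 1 3 5].  Copy
    [true] lies to the right of copy [false], whose hub extends just to the
    other hub. *)
Lemma linked_squares_grounded : grounded_L_graph R linked_squares.
Proof.
pose x (v : linked_squares) := (entry [:: 2; 4; 3; 5; 0; 6; 1] v + 10 * v.1)%N.
pose h := entry [:: 3; 5; 1; 4; 2; 7; 6]%N.
pose r (v : linked_squares) :=
  (entry [:: 5; 5; 6; 6; 4; 7; if v.1 then 6 else 11] v + 10 * v.1)%N.
have low_h v : (0 < h v)%N by move: v => [b [[|[|[|[|[|[|[|?]]]]]]] ?]].
have x_r v : (x v < r v)%N by move: v => [[] [[|[|[|[|[|[|[|?]]]]]]] ?]].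
exists (@coordinate_Lshape linked_squares x h (fun=> 0%N) r low_h x_r).
split=> //; apply: coordinate_Lshape_graph.
  exact: coordinates_inj.
by move=> [[] [[|[|[|[|[|[|[|?]]]]]]] ?]] [[] [[|[|[|[|[|[|[|?]]]]]]] ?]].
Qed.

(** All bends lie on the diagonal, the hubs being the first in their copies.
    The hub of copy [false] extends to the right just as far as the hub of copy
    [true], which reaches down to its level. *)
Lemma linked_squares_monotone : monotone_L_graph R linked_squares.
Proof.
pose x (v : linked_squares) :=
  (entry [:: 6; 10; 8; 12; 4; 14; 2] v + 20 * v.1)%N.
pose low (v : linked_squares) := (if v.2 == 6 :> nat then 1
               else entry [:: 3; 3; 7; 5; 1; 1] v + 20 * v.1)%N.
pose r (v : linked_squares) :=
  (entry [:: 13; 11; 15; 15; 11; 15; if v.1 then 15 else 23] v + 20 * v.1)%N.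
have low_x v : (low v < x v)%N by move: v => [[] [[|[|[|[|[|[|[|?]]]]]]] ?]].
have x_r v : (x v < r v)%N by move: v => [[] [[|[|[|[|[|[|[|?]]]]]]] ?]].
exists (@coordinate_Lshape linked_squares x x low r low_x x_r), 1, 0.
split=> [//|v|]; first by rewrite mul1r addr0.
apply: coordinate_Lshape_graph; first exact: coordinates_inj.
by move=> [[] [[|[|[|[|[|[|[|?]]]]]]] ?]] [[] [[|[|[|[|[|[|[|?]]]]]]] ?]].
Qed.
End Lshapes.

(** * Polygons inscribed in a circle *)

Section inscribed.
Variable R : realType.
Implicit Types (A B : set (R * R)) (S T : set R).

Lemma sub_convex_hull A : A `<=` convex_hull A.
Proof. exact: sub_smallest. Qed.

Lemma convex_hull_min A B : convex_set B -> A `<=` B -> convex_hull A `<=` B.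
Proof. by move=> cB AB; apply: smallest_sub. Qed.

Lemma convex_hull_conv A (p q : R * R) (l : R) :
  0 <= l <= 1 -> convex_hull A p -> convex_hull A q ->
  convex_hull A (l * p.1 + (1 - l) * q.1, l * p.2 + (1 - l) * q.2).
Proof.
move=> l01 pA qA B [cB AB].
have pB : (p : R * R) \in (B : set _) by rewrite inE; apply: pA.
have qB : (q : R * R) \in (B : set _) by rewrite inE; apply: qA.
have /andP[l0 l1] := l01.
have := cB p q (Itv01 l0 l1) pB qB.
by rewrite inE.
Qed.

Lemma hulls_separated A B (a b c : R) :
  (forall p, A p -> a * p.1 + b * p.2 + c <= 0) ->
  (forall p, B p -> 0 < a * p.1 + b * p.2 + c) ->
  ~ (convex_hull A `&` convex_hull B !=set0).
Proof.
move=> A0 B0 [p [pA pB]].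
suff : a * p.1 + b * p.2 + c <= 0 /\ 0 < a * p.1 + b * p.2 + c by case; lra.
have convE q1 q2 (k : R) : a * (k * q1.1 + (1 - k) * q2.1) +
    b * (k * q1.2 + (1 - k) * q2.2) + c =
    k * (a * q1.1 + b * q1.2 + c) + (1 - k) * (a * q2.1 + b * q2.2 + c).
  by ring.
split.
  apply: (convex_hull_min (B := [set p | a * p.1 + b * p.2 + c <= 0])) pA => //.
  apply/convex_setW => q1 q2; rewrite !inE /= => h1 h2 l l0 l1.
  by rewrite inE /= [X in X <= 0]convE; nra.
apply: (convex_hull_min (B := [set p | 0 < a * p.1 + b * p.2 + c])) pB => //.
apply/convex_setW => q1 q2; rewrite !inE /= => h1 h2 l l0 l1.
by rewrite inE /= [X in _ < X]convE; nra.
Qed.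

Section parametrization.
Variables (c e : R * R) (r : R).
Hypothesis r_gt0 : 0 < r.
Hypothesis e_unit : e.1 ^+ 2 + e.2 ^+ 2 = 1.

(** The stereographic parametrization of the circle, which reaches every point
    except [c - r e]. *)
Definition circle_pt (t : R) : R * R :=
  (c.1 + r * ((1 - t ^+ 2) * e.1 - 2 * t * e.2) / (1 + t ^+ 2),
   c.2 + r * ((1 - t ^+ 2) * e.2 + 2 * t * e.1) / (1 + t ^+ 2)).

Let den_gt0 (t : R) : 0 < 1 + t ^+ 2.
Proof. by rewrite ltr_pwDl// sqr_ge0. Qed.

Lemma circle_ptP (p : R * R) : circle c r p ->
  p != (c.1 - r * e.1, c.2 - r * e.2) -> exists t, p = circle_pt t.
Proof.
have r0 : r != 0 by rewrite gt_eqF.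
rewrite /circle/= => pc pO.
pose X := ((p.1 - c.1) * e.1 + (p.2 - c.2) * e.2) / r.
pose Y := ((p.2 - c.2) * e.1 - (p.1 - c.1) * e.2) / r.
have XE : p.1 = c.1 + r * (X * e.1 - Y * e.2).
  rewrite /X /Y; apply/eqP; rewrite -subr_eq0; apply/eqP.
  transitivity ((p.1 - c.1) * (1 - (e.1 ^+ 2 + e.2 ^+ 2))); last first.
    by rewrite e_unit subrr mulr0.
  by field.
have YE : p.2 = c.2 + r * (X * e.2 + Y * e.1).
  rewrite /X /Y; apply/eqP; rewrite -subr_eq0; apply/eqP.
  transitivity ((p.2 - c.2) * (1 - (e.1 ^+ 2 + e.2 ^+ 2))); last first.
    by rewrite e_unit subrr mulr0.
  by field.
have XY : X ^+ 2 + Y ^+ 2 = 1.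
  transitivity (((p.1 - c.1) ^+ 2 + (p.2 - c.2) ^+ 2) * (e.1 ^+ 2 + e.2 ^+ 2)
                / r ^+ 2).
    by rewrite /X /Y; field.
  by rewrite pc e_unit mulr1 divff// expf_neq0.
have X1 : 1 + X != 0.
  apply/negP => /eqP X1.
  have Y0 : Y = 0 by apply/eqP; rewrite -sqrf_eq0; apply/eqP; nra.
  have X1' : X = -1 by lra.
  apply: (elimN eqP pO); rewrite [LHS]surjective_pairing XE YE Y0 X1'.
  by congr (_, _); ring.
exists (Y / (1 + X)).
have D : 1 + (Y / (1 + X)) ^+ 2 = 2 / (1 + X).
  transitivity ((1 + 2 * X + (X ^+ 2 + Y ^+ 2)) / (1 + X) ^+ 2); first by field.
  by rewrite XY; field.
have N : 1 - (Y / (1 + X)) ^+ 2 = 2 * X / (1 + X).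
  transitivity (2 - (1 + (Y / (1 + X)) ^+ 2)); first by ring.
  by rewrite D; field.
rewrite /circle_pt D N; case: (p) XE YE => p1 p2 /= -> ->.
by congr (_, _); field.
Qed.

Lemma circle_pt_circle (t : R) : circle c r (circle_pt t).
Proof.
rewrite /circle /circle_pt /=; have := den_gt0 t => d0.
transitivity (r ^+ 2 * (e.1 ^+ 2 + e.2 ^+ 2)); last by rewrite e_unit mulr1.
by field; rewrite gt_eqF.
Qed.

(** In the parameter [t], the affine functions of the plane become the quotients
    by [1 + t ^+ 2] of the quadratic polynomials, so an arc is cut off by an
    affine function with given zeros. *)
Lemma circle_arc_disjoint S T (a b : R) :
  a <= b -> S `<=` `[a, b] -> T `&` `[a, b] = set0 ->
  ~ (convex_hull (circle_pt @` S) `&` convex_hull (circle_pt @` T) !=set0).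
Proof.
move=> ab Sab Tab.
(* With [X] and [Y] the coordinates along [e] and across it, scaled so that
   [X ^+ 2 + Y ^+ 2 = 1] on the circle, the affine function with coefficients
   [u], [v] and [w] is [(1 - X) - (a + b) Y + a b (1 + X)]. *)
pose u := ((a * b - 1) * e.1 + (a + b) * e.2) / r.
pose v := ((a * b - 1) * e.2 - (a + b) * e.1) / r.
pose w := 1 + a * b - u * c.1 - v * c.2.
have uvw t : u * (circle_pt t).1 + v * (circle_pt t).2 + w =
    2 * ((t - a) * (t - b)) / (1 + t ^+ 2).
  have d0 := den_gt0 t.
  transitivity (1 + a * b + ((a * b - 1) * (1 - t ^+ 2) - 2 * (a + b) * t) *
      (e.1 ^+ 2 + e.2 ^+ 2) / (1 + t ^+ 2)); last first.
    by rewrite e_unit; field; rewrite gt_eqF.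
  by rewrite /w /u /v /circle_pt /=; field; rewrite !gt_eqF.
apply: (hulls_separated (a := u) (b := v) (c := w)) => _ [t tX <-]; rewrite uvw.
  rewrite ler_pdivrMr// mul0r.
  by have := Sab _ tX; rewrite /= in_itv/= => /andP[? ?]; nra.
rewrite divr_gt0// mulr_gt0//.
have /negP : ~ t \in `[a, b].
  by move=> tab; have : (T `&` `[a, b]) t by []; rewrite Tab.
rewrite in_itv/= negb_and -!ltNge => /orP[ta|bt]; nra.
Qed.

(** The third divided difference at four points kills the quadratic polynomials,
    and its coefficients alternate in sign: this writes one point as a convex
    combination of the first and third points and of the second and fourth. *)
Lemma circle_chords_meet (t0 t1 t2 t3 : R) S T :
  t0 < t1 -> t1 < t2 -> t2 < t3 -> S t0 -> S t2 -> T t1 -> T t3 ->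
  convex_hull (circle_pt @` S) `&` convex_hull (circle_pt @` T) !=set0.
Proof.
move=> t01 t12 t23 S0 S2 T1 T3.
pose d0 := (t1 - t0) * (t2 - t0) * (t3 - t0).
pose d1 := (t1 - t0) * (t2 - t1) * (t3 - t1).
pose d2 := (t2 - t0) * (t2 - t1) * (t3 - t2).
pose d3 := (t3 - t0) * (t3 - t1) * (t3 - t2).
have [d0_gt0 d1_gt0 d2_gt0 d3_gt0] : [/\ 0 < d0, 0 < d1, 0 < d2 & 0 < d3].
  by split; rewrite !mulr_gt0// subr_gt0; lra.
have dd x y z :
    (x + y * t0 + z * t0 ^+ 2) / d0 + (x + y * t2 + z * t2 ^+ 2) / d2
    = (x + y * t1 + z * t1 ^+ 2) / d1 + (x + y * t3 + z * t3 ^+ 2) / d3.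
  by rewrite /d0 /d1 /d2 /d3; field; rewrite !subr_eq0 !gt_eqF//; lra.
pose w (t d : R) := (1 + t ^+ 2) / d.
have w_gt0 t d : 0 < d -> 0 < w t d by move=> dp; rewrite divr_gt0.
have [w0 w1 w2 w3] :
    [/\ 0 < w t0 d0, 0 < w t1 d1, 0 < w t2 d2 & 0 < w t3 d3].
  by split; exact: w_gt0.
have ww : w t0 d0 + w t2 d2 = w t1 d1 + w t3 d3.
  by have := dd 1 0 1; rewrite !mul0r !mul1r !addr0.
have pE1 t d : 0 < d -> w t d * (circle_pt t).1 =
    ((c.1 + r * e.1) + (- 2 * r * e.2) * t + (c.1 - r * e.1) * t ^+ 2) / d.
  by move=> dp; rewrite /w /circle_pt/=; field; rewrite !gt_eqF.
have pE2 t d : 0 < d -> w t d * (circle_pt t).2 =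
    ((c.2 + r * e.2) + (2 * r * e.1) * t + (c.2 - r * e.2) * t ^+ 2) / d.
  by move=> dp; rewrite /w /circle_pt/=; field; rewrite !gt_eqF.
have combE (u v s t : R) : 0 < u -> 0 < v ->
    u / (u + v) * s + (1 - u / (u + v)) * t = (u * s + v * t) / (u + v).
  by move=> u0 v0; field; rewrite gt_eqF ?addr_gt0.
have ratio (u v : R) : 0 < u -> 0 < v -> 0 <= u / (u + v) <= 1.
  move=> u0 v0; have uv0 : 0 < u + v by lra.
  by rewrite ler_pdivrMr// mul1r ltW ?divr_gt0//=; lra.
have hull (X : set R) t : X t -> convex_hull (circle_pt @` X) (circle_pt t).
  by move=> Xt; apply: sub_convex_hull; exists t.
have := convex_hull_conv (ratio _ _ w0 w2) (hull S t0 S0) (hull S t2 S2).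
have := convex_hull_conv (ratio _ _ w1 w3) (hull T t1 T1) (hull T t3 T3).
rewrite !combE// !pE1// !pE2// !dd ww => hT hS.
by eexists; split; [exact: hS|exact: hT].
Qed.
End parametrization.
End inscribed.

(** * The prism *)

Section blocks.
Variable R : realType.

Record block := Block {
  points : set R;
  lo : R;
  hi : R;
  lo_in : points lo;
  hi_in : points hi;
  in_block : forall t, points t -> lo <= t <= hi }.

Definition avoids (a b : R) (S : block) : Prop :=
  forall t, points S t -> t < a \/ b < t.

Definition separated (S T : block) : Prop :=
  avoids (lo S) (hi S) T \/ avoids (lo T) (hi T) S.

Lemma separatedC (S T : block) : separated S T -> separated T S.
Proof. by case; [right|left]. Qed.

Lemma avoidsW (a b a' b' : R) (S : block) :
  a <= a' -> b' <= b -> avoids a b S -> avoids a' b' S.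
Proof. by move=> aa bb aS t /aS; lra. Qed.

Lemma avoidsU (a b a' b' : R) (S : block) :
  a <= b' -> a' <= b -> avoids a b S -> avoids a' b' S ->
  avoids (Num.min a a') (Num.max b b') S.
Proof.
move=> ab ba aS aS' t tS; rewrite lt_min gt_max.
case: (aS t tS) => ?; case: (aS' t tS) => ?.
- by left; apply/andP.
- exfalso; lra.
- exfalso; lra.
- by right; apply/andP.
Qed.

Lemma lo_le_hi (S : block) : lo S <= hi S.
Proof. by have /andP[] := in_block (lo_in S). Qed.

Lemma not_separated_overlap (S T : block) : ~ separated S T -> lo S <= hi T.
Proof.
move=> nST; rewrite leNgt; apply/negP => ts; apply: nST; left => t /in_block.
by lra.
Qed.

Lemma not_separated_sub (a b : R) (S T : block) :
  ~ separated S T -> avoids a b S -> lo T < a \/ b < hi T.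
Proof.
move=> nST aS; apply: contrapT => /not_orP[/negP + /negP].
rewrite -!leNgt => aT Tb; apply: nST; right.
exact: avoidsW aT Tb aS.
Qed.

(** On the circle, two blocks that are not separated from each other lie in the
    same gap between consecutive points of a block separated from both. *)
Lemma avoids_same_gap (X S T : block) :
  separated X S -> separated X T -> ~ separated S T ->
  avoids (Num.min (lo S) (lo T)) (Num.max (hi S) (hi T)) X \/
  (avoids (lo X) (hi X) S /\ avoids (lo X) (hi X) T).
Proof.
have mixed S' T' : avoids (lo X) (hi X) S' -> avoids (lo T') (hi T') X ->
    ~ separated S' T' -> avoids (lo X) (hi X) T'.
  move=> XS TX nST; have := not_separated_sub nST XS.
  have := lo_le_hi X; have := lo_le_hi T'.
  have := TX _ (lo_in X); have := TX _ (hi_in X).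
  move=> + + ? ? + t /in_block/andP[? ?].
  by case=> ?; case=> ?; case=> ?; lra.
move=> [XS|SX] [XT|TX] nST.
- by right.
- by right; split=> //; apply: mixed XS TX nST.
- by right; split=> //; apply: mixed XT SX _ => /separatedC.
- left; apply: avoidsU => //; apply: not_separated_overlap => //.
  by move/separatedC.
Qed.

Record prism_blocks (x1 x2 x3 y1 y2 y3 : block) : Prop := PrismBlocks {
  x12 : ~ separated x1 x2; x23 : ~ separated x2 x3; x31 : ~ separated x3 x1;
  y12 : ~ separated y1 y2; y23 : ~ separated y2 y3; y31 : ~ separated y3 y1;
  xy11 : ~ separated x1 y1; xy22 : ~ separated x2 y2; xy33 : ~ separated x3 y3;
  xy12 : separated x1 y2; xy13 : separated x1 y3; xy21 : separated x2 y1;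
  xy23 : separated x2 y3; xy31 : separated x3 y1; xy32 : separated x3 y2 }.

Lemma prism_blocks_rot x1 x2 x3 y1 y2 y3 :
  prism_blocks x1 x2 x3 y1 y2 y3 -> prism_blocks x2 x3 x1 y2 y3 y1.
Proof. by case. Qed.

Definition around (x y z : block) : Prop :=
  avoids (Num.min (lo y) (lo z)) (Num.max (hi y) (hi z)) x.
Definition beside (x y z : block) : Prop :=
  avoids (lo x) (hi x) y /\ avoids (lo x) (hi x) z.

Section cases.
Variables x1 x2 x3 y1 y2 y3 : block.
Hypothesis P : prism_blocks x1 x2 x3 y1 y2 y3.

Let lohi := (lo_le_hi x1, lo_le_hi x2, lo_le_hi x3,
             lo_le_hi y1, lo_le_hi y2, lo_le_hi y3).

(** One of the blocks [y1], [y2] and [y3] lies in the interval spanned by the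
    two others.  Its partner avoids this interval, so the two are separated. *)
Lemma around3 : around x1 y2 y3 -> around x2 y3 y1 -> around x3 y1 y2 -> False.
Proof.
move=> r1 r2 r3.
have := not_separated_sub (xy11 P) r1.
have := not_separated_sub (xy22 P) r2.
have := not_separated_sub (xy33 P) r3.
rewrite !lt_min !gt_max.
by do 3 case=> /andP[? ?]; lra.
Qed.

(** The interval of [x3] sticks out of both spanned intervals, as [x3] is not
    separated from [x1] and [x2].  The blocks [y1] and [y2], which avoid it,
    then lie on different sides of it, although they are not separated. *)
Lemma around2 : around x1 y2 y3 -> around x2 y3 y1 -> beside x3 y1 y2 -> False.
Proof.
move=> r1 r2 [d1 d2].
have := not_separated_sub (xy11 P) r1.
have := not_separated_sub (xy22 P) r2.
have := not_separated_sub (fun s => x31 P (separatedC s)) r1.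
have := not_separated_sub (x23 P) r2.
have := d1 _ (lo_in y1); have := d1 _ (hi_in y1).
have := d2 _ (lo_in y2); have := d2 _ (hi_in y2).
have := not_separated_overlap (xy33 P).
have := not_separated_overlap (fun s => xy33 P (separatedC s)).
have := not_separated_overlap (y12 P).
have := not_separated_overlap (fun s => y12 P (separatedC s)).
have := lohi; rewrite !lt_min !gt_max => -[[[[[? ?] ?] ?] ?] ?] ? ? ? ? + + + +.
(do 4 case=> ?; try lra); do 4 (case=> /andP[? ?]; try lra).
Qed.

(** The intervals of [x2] and [x3] stick out of the interval spanned by [y2] and
    [y3].  On the same side they would both contain an end of that interval,
    but [y3] avoids the first of them and [y2] the second.  On different sides
    they cover it together, while [y1] avoids both, so that [y1] is separated
    from [y2]. *)
Lemma around1 : around x1 y2 y3 -> beside x2 y3 y1 -> beside x3 y1 y2 -> False.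
Proof.
move=> r1 [d23 d21] [d31 d32].
have u1 : around y1 x2 x3.
  apply: avoidsU d21 d31; apply: not_separated_overlap; first exact: (x23 P).
  by move/separatedC; exact: (x23 P).
have := not_separated_sub (xy11 P) r1.
have := not_separated_sub (x12 P) r1.
have := not_separated_sub (fun s => x31 P (separatedC s)) r1.
have := not_separated_sub (y12 P) u1.
have := not_separated_sub (fun s => y31 P (separatedC s)) u1.
have := d23 _ (lo_in y3); have := d23 _ (hi_in y3).
have := d32 _ (lo_in y2); have := d32 _ (hi_in y2).
have := not_separated_overlap (xy33 P).
have := not_separated_overlap (fun s => xy33 P (separatedC s)).
have := not_separated_overlap (xy22 P).
have := not_separated_overlap (fun s => xy22 P (separatedC s)).
have := lohi; rewrite !lt_min !gt_max => -[[[[[? ?] ?] ?] ?] ?] ? ? ? ? + + + +.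
(do 4 case=> ?; try lra); do 5 (case=> /andP[? ?]; try lra).
Qed.

(** Here the argument of [around3] applies with the two triangles exchanged. *)
Lemma around0 : beside x1 y2 y3 -> beside x2 y3 y1 -> beside x3 y1 y2 -> False.
Proof.
move=> [d12 d13] [d23 d21] [d31 d32].
have u1 : around y1 x2 x3.
  apply: avoidsU d21 d31; apply: not_separated_overlap; first exact: (x23 P).
  by move/separatedC; exact: (x23 P).
have u2 : around y2 x3 x1.
  apply: avoidsU d32 d12; apply: not_separated_overlap; first exact: (x31 P).
  by move/separatedC; exact: (x31 P).
have u3 : around y3 x1 x2.
  apply: avoidsU d13 d23; apply: not_separated_overlap; first exact: (x12 P).
  by move/separatedC; exact: (x12 P).
have := not_separated_sub (fun s => xy11 P (separatedC s)) u1.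
have := not_separated_sub (fun s => xy22 P (separatedC s)) u2.
have := not_separated_sub (fun s => xy33 P (separatedC s)) u3.
rewrite !lt_min !gt_max.
by do 3 case=> /andP[? ?]; lra.
Qed.
End cases.

Lemma no_prism_blocks x1 x2 x3 y1 y2 y3 : ~ prism_blocks x1 x2 x3 y1 y2 y3.
Proof.
move=> P1; have P2 := prism_blocks_rot P1; have P3 := prism_blocks_rot P2.
have c1 := avoids_same_gap (xy12 P1) (xy13 P1) (y23 P1).
have c2 := avoids_same_gap (xy12 P2) (xy13 P2) (y23 P2).
have c3 := avoids_same_gap (xy12 P3) (xy13 P3) (y23 P3).
case: c1 c2 c3 => [r1|d1] [r2|d2] [r3|d3].
- exact: around3 P1 r1 r2 r3.
- exact: around2 P1 r1 r2 d3.
- exact: around2 P3 r3 r1 d2.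
- exact: around1 P1 r1 d2 d3.
- exact: around2 P2 r2 r3 d1.
- exact: around1 P2 r2 d3 d1.
- exact: around1 P3 r3 d1 d2.
- exact: around0 P1 d1 d2 d3.
Qed.
End blocks.

Definition prism_adj : rel (bool * 'I_3) :=
  fun u v => if u.1 == v.1 then u.2 != v.2 else u.2 == v.2.

Lemma prism_sym : symmetric prism_adj.
Proof. by move=> u v; rewrite /prism_adj eq_sym (eq_sym u.2). Qed.

Lemma prism_irrefl : irreflexive prism_adj.
Proof. by move=> u; rewrite /prism_adj !eqxx. Qed.

Definition prism : sgraph := SGraph prism_sym prism_irrefl.

Section prism_filaments.
Variable R : realType.

Let center (i : 'I_3) : R := (2 * i.+1)%:R.
Let roof (i : 'I_3) (t : R) : R :=
  Num.min (Num.min (7 * t) (7 * (8 - t))) (`|t - center i| + 2^-1).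
Let bump (i : 'I_3) (t : R) : R := Num.max 0 (1 - `|t - center i|).

Let dist_continuous (a : R) : continuous (fun t : R => `|t - a|).
Proof.
move=> t; apply: (@continuous_comp _ _ _ (fun t => t - a) (fun t => `|t|)).
  by apply: cvgB; [exact: cvg_id|exact: cvg_cst].
exact: norm_continuous.
Qed.

Let roof_continuous i : continuous (roof i).
Proof.
move=> t; apply: (@continuous_min R R
  (fun t => Num.min (7 * t) (7 * (8 - t))) (fun t => `|t - center i| + 2^-1)).
  apply: (@continuous_min R R (fun t => 7 * t) (fun t => 7 * (8 - t))).
    by apply: cvgM; [exact: cvg_cst|exact: cvg_id].
  by apply: cvgM; [exact: cvg_cst|apply: cvgB; [exact: cvg_cst|exact: cvg_id]].
by apply: cvgD; [exact: dist_continuous|exact: cvg_cst].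
Qed.

Let bump_continuous i : continuous (bump i).
Proof.
move=> t; apply: (@continuous_max R R (fun=> 0) (fun t => 1 - `|t - center i|)).
  exact: cvg_cst.
by apply: cvgB; [exact: cvg_cst|exact: dist_continuous].
Qed.

Let center_range i : 2 <= center i <= 6.
Proof. by rewrite /center !ler_nat; case: i => -[|[|[|]]]. Qed.

Let center_sep i j : i != j -> 2 <= `|center i - center j|.
Proof.
rewrite -val_eqE => ij; rewrite ler_normr.
case: (ltngtP i j) ij => // lt _; apply/orP; [right|left].
  by rewrite /center opprB lerBrDr -natrD ler_nat; lia.
by rewrite /center lerBrDr -natrD ler_nat; lia.
Qed.

Let roofE i t : 1 <= t <= 7 -> roof i t = `|t - center i| + 2^-1.
Proof.
move=> t17; have := center_range i => c26.
by rewrite /roof min_r// le_min; apply/andP; split;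
  case: (ger0P (t - center i)) => h; lra.
Qed.

Let roof_ge0 i t : t \in `[0, 8] -> 0 <= roof i t.
Proof.
rewrite in_itv/= => t08; rewrite /roof !le_min addr_ge0// andbT.
by apply/andP; split; lra.
Qed.

Let bump_ge0 i t : t \in `[1, 7] -> 0 <= bump i t.
Proof. by move=> _; rewrite le_max lexx. Qed.

Let roof0 i : roof i 0 = 0.
Proof.
rewrite /roof mulr0 min_l.
  by rewrite min_l//; lra.
by rewrite min_l ?addr_ge0//; lra.
Qed.

Let roof8 i : roof i 8 = 0.
Proof.
rewrite /roof subrr mulr0 min_l.
  by rewrite min_r//; lra.
by rewrite min_r ?addr_ge0//; lra.
Qed.

Let bump1 i : bump i 1 = 0.
Proof.
have := center_range i => c26.
by apply/max_l; case: (ger0P (1 - center i)) => h; lra.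
Qed.

Let bump7 i : bump i 7 = 0.
Proof.
have := center_range i => c26.
by apply/max_l; case: (ger0P (7 - center i)) => h; lra.
Qed.

Let roof_within i : {within `[0, 8], continuous (roof i)}.
Proof. by apply: continuous_subspaceT; exact: roof_continuous. Qed.

Let bump_within i : {within `[1, 7], continuous (bump i)}.
Proof. by apply: continuous_subspaceT; exact: bump_continuous. Qed.

Let roof_filament i : filament R :=
  @Filament R 0 8 (roof i) ltac:(lra) (@roof_within i)
    (roof0 i) (roof8 i) (@roof_ge0 i).

Let bump_filament i : filament R :=
  @Filament R 1 7 (bump i) ltac:(lra) (@bump_within i)
    (bump1 i) (bump7 i) (@bump_ge0 i).

Let roof_bump i j : i != j -> ~ meets (roof_filament i) (bump_filament j).
Proof.
move=> /center_sep ij [t [/= _]]; rewrite in_itv/= => t17.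
rewrite roofE// /bump.
have tri : `|center i - center j| <= `|t - center i| + `|t - center j|.
  by rewrite (distrC t (center i)); apply: ler_distD.
have := normr_ge0 (t - center i).
by case: (leP 0 (1 - `|t - center j|)) => h h1 h2; lra.
Qed.

(** Filaments of one triangle share their ends.  The roof over [center i] hangs
    down far enough to touch the bump at [center i], and lies above the two
    others. *)
Lemma prism_filament : interval_filament_graph R prism.
Proof.
apply/filament_graphP.
pose F (v : prism) := if v.1 then roof_filament v.2 else bump_filament v.2.
exists F => -[b i] [c j]; wlog bc : b c i j / c ==> b.
  move=> H ne; case: b c ne H => -[] ne H; try exact: (H _ _ i j).
  rewrite adj_sym; split=> [|/meetsC] h.
    by apply/meetsC/(H _ _ j i) => //; rewrite eq_sym.
  by apply/(H _ _ j i) => //; rewrite eq_sym.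
rewrite xpair_eqE /= /prism_adj /F /=.
case: b c bc => -[] //= _ ij.
- split=> // _; exists 0; split; rewrite /= ?roof0// in_itv/=; lra.
- have [->|nij] := eqVneq i j; last by split=> // /(roof_bump nij).
  split=> // _; exists (center j + 4^-1); have := center_range j => c26.
  have t17 : 1 <= center j + 4^-1 <= 7 by lra.
  split; rewrite /= ?in_itv/=; [lra|lra|].
  rewrite roofE// /bump addrAC subrr add0r ger0_norm ?invr_ge0//.
  by rewrite max_r; lra.
- split=> // _; exists 1; split; rewrite /= ?bump1// in_itv/=; lra.
Qed.
End prism_filaments.

Section prism_polygons.
Variable R : realType.

Lemma block_of_seq (s : seq R) : s != [::] ->
  exists S : block R, points S = [set` s].
Proof.
elim: s => //= x [_ _|y s IH _].
  have xx t : t \in [:: x] -> x <= t <= x.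
    by rewrite inE => /eqP ->; rewrite lexx.
  by exists (@Block R [set` [:: x]] x x (mem_head x [::]) (mem_head x [::]) xx).
have [S SE] := IH isT.
pose T : set R := [set` x :: y :: s].
have TE t : T t <-> t = x \/ points S t.
  rewrite SE /T /= !inE; split=> [/orP[/eqP|]|[->|->]]; rewrite ?eqxx ?orbT//.
    by left.
  by right.
have T_lo : T (Num.min x (lo S)).
  by apply/TE; case: leP => _; [left|right; apply: lo_in].
have T_hi : T (Num.max x (hi S)).
  by apply/TE; case: leP => _; [right; apply: hi_in|left].
have T_in t : T t -> Num.min x (lo S) <= t <= Num.max x (hi S).
  rewrite ge_min le_max => /TE[->|/in_block/andP[-> ->]]; first by rewrite lexx.
  by rewrite !orbT.
by exists (Block T_lo T_hi T_in).
Qed.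

Lemma exists_notin (s : seq R) : exists x, x \notin s.
Proof.
have [->|/block_of_seq[S SE]] := eqVneq s [::]; first by exists 0.
exists (hi S + 1); apply/negP => hs.
have : points S (hi S + 1) by rewrite SE.
by move/in_block; lra.
Qed.

Variables (c : R * R) (r : R).
Hypothesis r_gt0 : 0 < r.

(** If neither block avoids the interval of the other one and they share no
    point, then some four of their points alternate, and two chords cross. *)
Lemma separated_disjoint e (S T : block R) : e.1 ^+ 2 + e.2 ^+ 2 = 1 ->
  separated S T <-> ~ (convex_hull (circle_pt c e r @` points S) `&`
                       convex_hull (circle_pt c e r @` points T) !=set0).
Proof.
move=> e1; split.
  have half (S' T' : block R) : avoids (lo S') (hi S') T' ->
      ~ (convex_hull (circle_pt c e r @` points S') `&`
         convex_hull (circle_pt c e r @` points T') !=set0).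
    move=> a; apply: (circle_arc_disjoint (S := points S') (T := points T')
      r_gt0 e1 (lo_le_hi S')).
      by move=> t /in_block; rewrite /= in_itv.
    rewrite -subset0 => t [/a + /=]; rewrite in_itv/=; lra.
  by case=> [/half//|/half]; rewrite setIC.
move=> nST; apply: contrapT => /not_orP[nS nT].
have pick (S' T' : block R) : ~ avoids (lo S') (hi S') T' ->
    exists2 t, points T' t & lo S' <= t <= hi S'.
  move=> /existsNP[t /not_implyP[tT /not_orP[/negP + /negP]]].
  by rewrite -!leNgt => ? ?; exists t => //; apply/andP.
have [t tT tS] := pick _ _ nS; have [s sS sT] := pick _ _ nT.
have share x : points S x -> points T x -> False.
  move=> xS xT; apply: nST; exists (circle_pt c e r x).
  by split; apply: sub_convex_hull; exists x.
have ne x y : points S x -> points T y -> x != y.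
  by move=> xS yT; apply/eqP => xy; apply: (share x) => //; rewrite xy.
have := ne _ _ (lo_in S) tT; have := ne _ _ (hi_in S) tT.
have := ne _ _ sS (lo_in T); have := ne _ _ sS (hi_in T).
have := ne _ _ (lo_in S) (lo_in T); have := ne _ _ (hi_in S) (hi_in T).
rewrite !neq_lt => hh ll sh sl ht lt.
have chords := circle_chords_meet c e r.
case/orP: ll => ll; last first.
  apply: nST; rewrite setIC.
  by apply: (chords (lo T) (lo S) t (hi S)) => //;
    first [exact: lo_in|exact: hi_in|lra].
case/orP: hh => hh; apply: nST.
  by apply: (chords (lo S) t (hi S) (hi T)) => //;
    first [exact: lo_in|exact: hi_in|lra].
by apply: (chords (lo S) (lo T) s (hi T)) => //;
  first [exact: lo_in|exact: hi_in|lra].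
Qed.

(** The point at infinity of the stereographic parameter is chosen off the
    corners of all the polygons. *)
Lemma polygons_blocks (V : finType) (F : V -> set (R * R)) :
  (forall v, inscribed_polygon c r (F v)) ->
  exists B : V -> block R,
    forall u v, separated (B u) (B v) <-> ~ (F u `&` F v !=set0).
Proof.
move=> /choice[s sP].
pose e0 : R * R := (1, 0).
pose slope (p : R * R) := (p.2 - c.2) / (p.1 - c.1 + r).
have [t0 t0s] :=
  exists_notin (flatten [seq [seq slope p | p <- s v] | v <- enum V]).
pose q := circle_pt c e0 r t0.
have e0_unit : e0.1 ^+ 2 + e0.2 ^+ 2 = 1 by rewrite /= expr1n expr0n addr0.
have d0 : 1 + t0 ^+ 2 != 0 by rewrite gt_eqF// ltr_pwDl// sqr_ge0.
have slope_q : slope q = t0.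
  rewrite /slope /q /circle_pt /=; field.
  rewrite d0 [X in X != 0](_ : _ = 2 * r); last by rewrite /=; ring.
  by rewrite mulf_neq0// gt_eqF.
pose e : R * R := ((c.1 - q.1) / r, (c.2 - q.2) / r).
have r0 : r != 0 by rewrite gt_eqF.
have e_unit : e.1 ^+ 2 + e.2 ^+ 2 = 1.
  have := circle_pt_circle c r e0_unit t0; rewrite -/q /circle /= => qc.
  transitivity (((q.1 - c.1) ^+ 2 + (q.2 - c.2) ^+ 2) / r ^+ 2).
    by rewrite /e /=; field; rewrite r0 d0.
  by rewrite qc divff// expf_neq0.
have qE : (c.1 - r * e.1, c.2 - r * e.2) = q.
  by rewrite [RHS]surjective_pairing /e /=; congr (_, _); field; rewrite r0 d0.
have blocks v : exists B : block R,
    F v = convex_hull (circle_pt c e r @` points B).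
  have [_ s2 sc ->] := sP v.
  have param p : p \in s v -> exists t, p = circle_pt c e r t.
    move=> ps; apply: (circle_ptP r_gt0 e_unit (sc p ps)).
    rewrite qE; apply: contraNneq t0s => pq; rewrite -slope_q -pq.
    by apply/flatten_mapP; exists v; rewrite ?mem_enum// map_f.
  have /choice[f fP] p : exists t, p \in s v -> p = circle_pt c e r t.
    by have [/param[t pE]|_] := boolP (p \in s v); [exists t|exists 0].
  have fs0 : map f (s v) != [::] by rewrite -size_eq0 size_map; case: size s2.
  have [B BE] := block_of_seq fs0.
  exists B; congr convex_hull; rewrite BE; apply/seteqP; split=> [p ps|].
    by exists (f p); [exact: map_f|rewrite -fP].
  by move=> _ [_ /mapP[p ps ->] <-]; rewrite -fP.
have [B BE] := choice blocks.
by exists B => u v; rewrite !BE; apply: separated_disjoint.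
Qed.
End prism_polygons.

Lemma prism_not_polygon_circle (R : realType) : ~ polygon_circle_graph R prism.
Proof.
move=> [c [r [F [r_gt0 FP FG]]]].
have [B BP] := polygons_blocks r_gt0 FP.
pose x i : prism := (false, inZp i : 'I_3).
pose y i : prism := (true, inZp i : 'I_3).
have meet (u v : prism) : u != v -> adj u v -> ~ separated (B u) (B v).
  by move=> uv a /BP; apply; apply/FG.
have apart (u v : prism) : u != v -> ~~ adj u v -> separated (B u) (B v).
  by move=> uv /negP na; apply/BP => /(FG _ _ uv).
apply: (@no_prism_blocks R (B (x 0)) (B (x 1)) (B (x 2))
                           (B (y 0)) (B (y 1)) (B (y 2)))%N.
by split; first [exact: meet|exact: apart].
Qed.

(** * Crossing curves in a half-plane *)

Section parity.
Variable T : Type.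

Fixpoint step_parity (e : rel T) (z : T) (s : seq T) : bool :=
  if s is w :: s' then e z w (+) step_parity e w s' else false.

Lemma step_parity_boundary (a : pred T) (z : T) (s : seq T) :
  step_parity (fun u v => a u (+) a v) z s = a z (+) a (last z s).
Proof.
elim: s z => [|w s IH] z /=; first by rewrite addbb.
by rewrite IH addbA -(addbA (a z)) addbb addbF.
Qed.

Lemma step_parityD (e e' : rel T) (z : T) (s : seq T) :
  step_parity (fun u v => e u v (+) e' u v) z s =
  step_parity e z s (+) step_parity e' z s.
Proof. by elim: s z => //= w s IH z; rewrite IH addbACA. Qed.

Lemma eq_step_parity (r e e' : rel T) (P : pred T) (z : T) (s : seq T) :
  (forall u v, P u -> P v -> r u v -> e u v = e' u v) ->
  P z -> all P s -> path r z s -> step_parity e z s = step_parity e' z s.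
Proof.
move=> ee; elim: s z => //= w s IH z Pz /andP[Pw Ps] /andP[zw ws].
by rewrite (ee z w)// IH.
Qed.
End parity.

Section rook.
Local Notation cell := (int * int)%type.

Definition rook : rel cell := fun z w =>
  ((z.1 == w.1) && (`|z.2 - w.2| <= 1)) ||
  ((z.2 == w.2) && (`|z.1 - w.1| <= 1)).

Lemma rookP (z w : cell) : rook z w ->
  exists2 d, w = (z.1 + d.1, z.2 + d.2) &
             d \in [:: (0, 0); (1, 0); (-1, 0); (0, 1); (0, -1)].
Proof.
case: z w => [z1 z2] [w1 w2]; rewrite /rook /= => zw.
exists (w1 - z1, w2 - z2); first by rewrite /= !(addrC _ (_ - _)) !subrK.
rewrite !inE !xpair_eqE; lia.
Qed.

(** The parity of the number of steps over the point just to the right of [p]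
    tells on which side of a path from ground to ground the cell [p] lies. *)
Definition over (p : cell) : rel cell := fun z w =>
  [&& z.2 == w.2, p.2 < z.2 & (z.1 <= p.1) (+) (w.1 <= p.1)].

(** Between neighbouring cells the condition [over] changes on the steps across
    the boundary of the part of the right column that lies over them. *)
Definition column_over (p q : cell) : pred cell :=
  fun z => [&& p.1 != q.1, z.1 == Num.max p.1 q.1 & p.2 < z.2].

Lemma over_boundary (p q u v : cell) : rook p q -> rook u v ->
  (u != p) && (u != q) -> (v != p) && (v != q) ->
  over p u v (+) over q u v = column_over p q u (+) column_over p q v.
Proof.
move=> /rookP[d -> dP] /rookP[d' -> dP']; rewrite /over /column_over.
case: p u => [p1 p2] [u1 u2]; rewrite !xpair_eqE /=.
move: dP dP'; rewrite !inE.
by case/or4P=> [/eqP->|/eqP->|/eqP->|/orP[/eqP->|/eqP->]];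
  case/or4P=> [/eqP->|/eqP->|/eqP->|/orP[/eqP->|/eqP->]] /=; lia.
Qed.

Lemma over_step (z0 p q : cell) (s : seq cell) :
  rook p q -> 0 <= p.2 -> path rook z0 s ->
  p \notin z0 :: s -> q \notin z0 :: s -> z0.2 = 0 -> (last z0 s).2 = 0 ->
  step_parity (over p) z0 s = step_parity (over q) z0 s.
Proof.
move=> pq p0 zs; rewrite !inE !negb_or.
move=> /andP[pz ps] /andP[qz qs] z0_ground l0.
suff : step_parity (fun z w => over p z w (+) over q z w) z0 s = false.
  by rewrite step_parityD; case: step_parity; case: step_parity.
transitivity (column_over p q z0 (+) column_over p q (last z0 s)); last first.
  by rewrite /column_over z0_ground l0 ltNge p0 !andbF.
rewrite -step_parity_boundary.
apply: (@eq_step_parity _ rook _ _ (fun z => (z != p) && (z != q))) zs.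
- by move=> u v up vp uv; apply: over_boundary.
- by rewrite eq_sym pz eq_sym qz.
- apply/allP => z zs; apply/andP.
  by split; [apply: contraNneq ps => <-|apply: contraNneq qs => <-].
Qed.

Lemma over_ground (z0 : cell) (b : int) (s : seq cell) :
  path rook z0 s -> all (fun z => 0 <= z.2) (z0 :: s) ->
  (b, 0) \notin z0 :: s ->
  step_parity (over (b, 0)) z0 s = (z0.1 <= b) (+) ((last z0 s).1 <= b).
Proof.
move=> zs /andP[z00 s0]; rewrite inE negb_or => /andP[bz bs].
rewrite -(step_parity_boundary (fun z => z.1 <= b)).
apply: (@eq_step_parity _ rook _ _ (fun z => (0 <= z.2) && (z != (b, 0)))) zs.
- move=> [u1 u2] [v1 v2]; rewrite /rook /over !xpair_eqE /=.
  lia.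
- by rewrite z00 eq_sym.
- by apply/allP => z zs; rewrite (allP s0)//=; apply: contraNneq bs => <-.
Qed.

Lemma rook_paths_meet (a1 a2 b1 b2 : int) (sA sB : seq cell) :
  a1 <= b1 -> b1 < a2 -> a2 <= b2 ->
  path rook (a1, 0) sA -> last (a1, 0) sA = (a2, 0) ->
  path rook (b1, 0) sB -> last (b1, 0) sB = (b2, 0) ->
  all (fun z => 0 <= z.2) sA -> all (fun z => 0 <= z.2) sB ->
  has (mem ((a1, 0) :: sA)) ((b1, 0) :: sB).
Proof.
move=> ab ba ab2 pA lA pB lB posA posB; apply/negPn/negP => /hasPn dis.
have disA z : z \in (b1, 0) :: sB -> z \notin (a1, 0) :: sA by exact: dis.
have : step_parity (over (b1, 0)) (a1, 0) sA =
       step_parity (over (b2, 0)) (a1, 0) sA.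
  rewrite -lB; have : 0 <= (b1, 0 : int).2 by [].
  elim: sB (b1, 0) pB posB disA {dis lB} => //= w s IH p.
  move=> /andP[pw ws] /andP[w0 s0] D p0.
  rewrite -IH//; last by move=> z zs; apply: D; rewrite inE zs orbT.
  apply: over_step; rewrite ?lA//; apply: D; rewrite !inE eqxx ?orbT//.
rewrite !over_ground ?lA//=; [lia|..].
- by apply: disA; rewrite -lB mem_last.
- by apply: disA; rewrite mem_head.
Qed.
End rook.

Section crossing.
Variable R : realType.
Local Notation plane := (R * R)%type.
Implicit Types A B : set plane.

Definition close (e : R) : rel plane := fun z w =>
  (`|z.1 - w.1| < e) && (`|z.2 - w.2| < e).

Lemma ball_close (e : R) (z w : plane) : ball z e w <-> close e z w.
Proof. by split=> [[? ?]|/andP[? ?]]; [apply/andP|]; split. Qed.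

(** The points that can be reached form a set that is open and closed in [A]. *)
Lemma connected_chain A (x y : plane) (e : R) :
  connected A -> A x -> A y -> 0 < e ->
  exists s, [/\ path (close e) x s, last x s = y & forall z, z \in s -> A z].
Proof.
move=> cA Ax Ay e0.
pose chain z s :=
  [/\ path (close e) x s, last x s = z & forall w, w \in s -> A w].
have close_refl z : close e z z by rewrite /close !subrr normr0 e0.
pose B := [set z | A z /\ exists s, chain z s].
have step z w : B z -> A w -> close e z w -> B w.
  move=> [_ [s [xs sz sA]]] Aw zw; split=> //; exists (rcons s w); split.
  - by rewrite rcons_path xs sz.
  - by rewrite last_rcons.
  - by move=> v; rewrite mem_rcons inE => /orP[/eqP ->|/sA].
have Bx : B x by split=> //; exists [::].
suff BA : B = A by have [_] : B y by rewrite BA.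
apply: cA; first by exists x.
  exists (\bigcup_(z in B) ball z e).
    by apply: bigcup_open => z _; apply: ball_open.
  apply/seteqP; split=> [z Bz|z [Az [w Bw /ball_close wz]]].
    by split; [case: Bz|exists z => //; apply/ball_close].
  exact: step wz.
exists (~` \bigcup_(z in A `\` B) ball z e).
  by apply: open_closedC; apply: bigcup_open => z _; apply: ball_open.
apply/seteqP; split=> [z Bz|z [Az nz]].
  split; first by case: Bz.
  move=> [w [Aw nBw] /ball_close]; rewrite /close !(distrC w.1) !(distrC w.2).
  by move=> zw; apply: nBw; apply: step zw.
apply: contrapT => nBz; apply: nz; exists z => //; exact/ball_close.
Qed.

Lemma compact_apart A B : compact A -> compact B -> A !=set0 -> B !=set0 ->
  A `&` B = set0 -> exists2 e, 0 < e & forall a b, A a -> B b -> ~ close e a b.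
Proof.
move=> cA cB [a0 Aa0] [b0 Bb0] AB.
pose dist (p : plane * plane) : R := `|p.1 - p.2|.
have dist_cont : continuous dist.
  move=> p; apply: (@continuous_comp _ _ _ (fun p : plane * plane => p.1 - p.2)
                     (fun q : plane => `|q|)); last exact: norm_continuous.
  by apply: cvgB; [exact: cvg_fst|exact: cvg_snd].
have [|[a b] abAB min] := @compact_EVT_min _ _ dist _ _ (compact_setX cA cB)
    (continuous_subspaceT dist_cont).
  by exists (a0, b0).
move: abAB; rewrite inE => -[/= Aa Bb].
exists (dist (a, b)).
  rewrite normr_gt0 subr_eq0; apply/eqP => /= ab.
  have : (A `&` B) a by split; rewrite // ab.
  by rewrite AB.
move=> a' b' Aa' Bb' /andP[h1 h2].
have /min : (a', b') \in A `*` B by rewrite inE.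
by rewrite leNgt {1}/dist prod_normE gt_max h1 h2.
Qed.

Section grid.
Variables (l e : R).
Hypothesis e_gt0 : 0 < e.

Definition cell_of (z : plane) : int * int :=
  (Num.floor (z.1 / e), Num.floor ((z.2 - l) / e)).

Definition cell_near A (c : int * int) : Prop :=
  exists2 z, A z &
    `|c.1%:~R * e - z.1| <= 2 * e /\ `|c.2%:~R * e + l - z.2| <= 2 * e.

Let e_le2 : e <= 2 * e.
Proof. by move: e_gt0; lra. Qed.

Lemma floor_mul (x : R) : `|(Num.floor (x / e))%:~R * e - x| <= e.
Proof.
have /andP[h1 h2] := floor_itv (x / e).
move: h1 h2; rewrite ler_pdivlMr// ltr_pdivrMr// intrD mulrDl mul1r => h1 h2.
rewrite ler_norml; lra.
Qed.

Lemma floor_close (x y : R) : `|x - y| < e ->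
  `|Num.floor (x / e) - Num.floor (y / e)| <= 1.
Proof.
move=> xy.
have xy1 : `|x / e - y / e| < 1.
  rewrite -mulrBl normrM (gtr0_norm (x := e^-1)) ?invr_gt0//.
  by rewrite ltr_pdivrMr// mul1r.
have /andP[h1 h2] := floor_itv (x / e); have /andP[h3 h4] := floor_itv (y / e).
move: xy1; rewrite ltr_norml => /andP[h5 h6].
have : (Num.floor (x / e))%:~R < (Num.floor (y / e) + 2)%:~R :> R.
  by move: h4; rewrite !intrD; lra.
have : (Num.floor (y / e))%:~R < (Num.floor (x / e) + 2)%:~R :> R.
  by move: h2; rewrite !intrD; lra.
by rewrite !ltr_int; lia.
Qed.

(** A chain of close points passes through a chain of cells, after insertion of
    a corner where it moves diagonally. *)
Lemma chain_rook A (x : plane) (s : seq plane) :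
  (forall z, A z -> l <= z.2) -> A x -> (forall z, z \in s -> A z) ->
  path (close e) x s ->
  exists t, [/\ path rook (cell_of x) t,
                last (cell_of x) t = cell_of (last x s) &
                forall c, c \in t -> cell_near A c /\ 0 <= c.2].
Proof.
move=> Al; have cell_ge0 z : A z -> 0 <= Num.floor ((z.2 - l) / e).
  by move=> /Al lz; rewrite floor_ge0 divr_ge0 ?subr_ge0// ltW.
elim: s x => [|w s IH] x Ax sA /=; first by exists [::].
move=> /andP[/andP[xw1 xw2] ws].
have Aw : A w by apply: sA; rewrite mem_head.
have [|t [wt lt tA]] := IH w Aw _ ws.
  by move=> z zs; apply: sA; rewrite inE zs orbT.
have xw2' : `|(x.2 - l) - (w.2 - l)| < e by rewrite opprB addrA subrK.
exists ((Num.floor (w.1 / e), Num.floor ((x.2 - l) / e)) :: cell_of w :: t).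
have shiftE (y : R) : `|(Num.floor ((y - l) / e))%:~R * e + l - y| <= e.
  by rewrite -addrA -(opprB y l); exact: floor_mul.
split=> [/=||c].
- by rewrite wt /rook /= !eqxx (floor_close xw1) (floor_close xw2') !orbT.
- by rewrite /= -lt.
- rewrite !inE => /or3P[/eqP ->|/eqP ->|/tA//]; split; rewrite /= ?cell_ge0//;
    exists w => //=; split.
  + exact: le_trans (floor_mul _) e_le2.
  + apply: le_trans (ler_distD x.2 _ _) _.
    by apply: le_trans (lerD (shiftE _) (ltW xw2)) _; rewrite mulr_natl.
  + exact: le_trans (floor_mul _) e_le2.
  + exact: le_trans (shiftE _) e_le2.
Qed.

End grid.

(** Two continua in a closed half-plane whose feet alternate meet: otherwise
    they are apart, and at a scale finer than their distance they are traced by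
    paths of cells without a common cell. *)
Theorem alternating_continua_meet A B (l a1 a2 b1 b2 : R) :
  compact A -> connected A -> compact B -> connected B ->
  (forall z, A z -> l <= z.2) -> (forall z, B z -> l <= z.2) ->
  A (a1, l) -> A (a2, l) -> B (b1, l) -> B (b2, l) ->
  a1 < b1 -> b1 < a2 -> a2 < b2 -> A `&` B !=set0.
Proof.
move=> kA cA kB cB Al Bl Aa1 Aa2 Bb1 Bb2 a1b1 b1a2 a2b2.
apply: contrapT => /nonemptyPn AB.
have [d d0 apart] :=
  compact_apart kA kB (ex_intro _ _ Aa1) (ex_intro _ _ Bb1) AB.
pose e := d / 5; have e0 : 0 < e by rewrite /e; lra.
have no_common c : cell_near l e A c -> cell_near l e B c -> False.
  move=> [z Az [h1 h2]] [w Bw [h3 h4]]; apply: (apart z w) => //.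
  have dE : d = 5 * e by rewrite /e; field.
  move: h1 h2 h3 h4; rewrite /close !ler_norml !ltr_norml => ? ? ? ?.
  by apply/andP; split; lra.
have near_cell D z : D z -> cell_near l e D (cell_of l e z).
  move=> Dz; exists z => //; split.
    by apply: le_trans (floor_mul e0 _) _; lra.
  rewrite /= -addrA -(opprB z.2 l).
  by apply: le_trans (floor_mul e0 _) _; lra.
have [s [sa sa2 sA]] := connected_chain cA Aa1 Aa2 e0.
have [t [tb tb2 tB]] := connected_chain cB Bb1 Bb2 e0.
have [s' [ps ls sA']] := chain_rook e0 Al Aa1 sA sa.
have [t' [pt lt tB']] := chain_rook e0 Bl Bb1 tB tb.
have groundE x : cell_of l e (x, l) = (Num.floor (x / e), 0).
  by rewrite /cell_of /= subrr mul0r floor0.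
rewrite sa2 !groundE in ls; rewrite groundE in ps.
have floor_mono x y : x < y -> Num.floor (x / e) <= Num.floor (y / e).
  by move=> xy; apply: le_floor; rewrite ler_pM2r ?invr_gt0// ltW.
have groundA : cell_near l e A (Num.floor (a2 / e), 0).
  by rewrite -groundE; exact: near_cell.
have groundB : cell_near l e B (Num.floor (b1 / e), 0).
  by rewrite -groundE; exact: near_cell.
have ba : Num.floor (b1 / e) < Num.floor (a2 / e).
  rewrite lt_neqAle floor_mono// andbT; apply/eqP => ba.
  by apply: (no_common _ groundA); rewrite -ba.
have posA : all (fun z => 0 <= z.2) s' by apply/allP => z /sA'[].
have posB : all (fun z => 0 <= z.2) t' by apply/allP => z /tB'[].
rewrite tb2 !groundE in lt; rewrite groundE in pt.
have /hasP[c cB' cA'] := rook_paths_meet (floor_mono _ _ a1b1) ba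
  (floor_mono _ _ a2b2) ps ls pt lt posA posB.
apply: (no_common c).
  move: cA'; rewrite /= inE => /orP[/eqP ->|/sA'[]//].
  by rewrite -groundE; exact: near_cell.
move: cB'; rewrite inE => /orP[/eqP ->|/tB'[]//].
by rewrite -groundE; exact: near_cell.
Qed.
End crossing.

(** * A pattern that simple grounded strings avoid *)

Section strings.
Variable R : realType.
Local Notation plane := (R * R)%type.
Implicit Types K L A : set plane.

Definition continuum K : Prop := compact K /\ connected K.

Lemma continuumU K L : K `&` L !=set0 ->
  continuum K -> continuum L -> continuum (K `|` L).
Proof.
by move=> KL [kK cK] [kL cL]; split; [exact: compactU|exact: connectedU].
Qed.

Lemma curve_continuum (gamma : R -> plane) (s t : R) :
  {within `[0, 1], continuous gamma} -> s \in `[0, 1] -> t \in `[0, 1] ->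
  continuum (gamma @` `[Num.min s t, Num.max s t]).
Proof.
move=> cg s01 t01.
have sub : `[Num.min s t, Num.max s t] `<=` `[0, 1].
  move=> r; move: s01 t01.
  by rewrite /= !in_itv/= ge_min le_max; case: leP; lra.
split.
  apply: continuous_compact (@segment_compact _ _ _).
  exact: continuous_subspaceW sub cg.
apply: connected_continuous_connected (@segment_connected _ _ _) _.
exact: continuous_subspaceW sub cg.
Qed.

(** The arc [J] ends at a visit to [q] that is closest in time to a visit to
    [a], so its points before the end are reached from [a] without passing
    through [q], however often the curve intersects itself. *)
Lemma grounded_string_reaches (l : R) A (a q : plane) :
  grounded_string l A -> A a -> A q ->
  exists J, [/\ continuum J, J `<=` A, J a, J q &
    forall z, J z -> z != q ->
      exists K, [/\ continuum K, K `<=` A, K a, K z & ~ K q]].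
Proof.
move=> [g [cg _ _ ->]] [s s01 sa] [t t01 tq].
have clq : closed [set q].
  exact/accessible_closed_set1/hausdorff_accessible/norm_hausdorff.
have [V clV VE] : exists2 V : set R, closed V &
    forall r, r \in `[0, 1] -> V r <-> g r = q.
  have /continuous_closedP/(_ _ clq)/closed_subspaceP[V clV VE] := cg.
  exists V => // r r01; split=> [Vr|gr].
    by have [] : (g @^-1` [set q] `&` `[0, 1]) r by rewrite -VE.
  by have [] : (V `&` `[0, 1]) r by rewrite VE.
have kQ : compact (`[0, 1] `&` V).
  by apply: compact_closedI => //; exact: segment_compact.
have [] := @compact_EVT_min _ _ (fun r => `|r - s|) (`[0, 1] `&` V) _ kQ _.
- by exists t; split=> //; apply/VE.
- apply: continuous_subspaceT => r; apply: cvg_norm.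
  by apply: cvgB; [exact: cvg_id|exact: cvg_cst].
move=> r; rewrite inE => -[r01 Vr] rmin.
have rq : g r = q by apply/VE.
exists (g @` `[Num.min s r, Num.max s r]).
have sub r' : r' \in `[0, 1] -> `[Num.min s r', Num.max s r'] `<=` `[0, 1].
  move=> r'01 x; move: s01 r'01.
  by rewrite /= !in_itv/= ge_min le_max; case: leP; lra.
have ends (x y : R) : x \in `[Num.min x y, Num.max x y] /\
                      y \in `[Num.min x y, Num.max x y].
  by rewrite !in_itv/= !ge_min !le_max !lexx !orbT.
split.
- exact: curve_continuum.
- exact/image_subset/sub.
- by exists s => //; case: (ends s r).
- by exists r => //; case: (ends s r).
move=> _ [z zsr <-] zq; have z01 := sub r r01 _ zsr.
exists (g @` `[Num.min s z, Num.max s z]); split.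
- exact: curve_continuum.
- exact/image_subset/sub.
- by exists s => //; case: (ends s z).
- by exists z => //; case: (ends s z).
- move=> [y ysz yq]; have y01 := sub z z01 _ ysz.
  have : y \in `[0, 1] `&` V by rewrite inE; split=> //; apply/VE.
  move=> /rmin ry.
  suff rz : r = z by move: zq; rewrite -rz rq eqxx.
  move: zsr ysz ry; rewrite /= !in_itv/=.
  have [sr|rs] := leP s r => szr; have [sz|zs] := leP s z => ysz.
  - by rewrite !ger0_norm; lra.
  - by lra.
  - by rewrite !ler0_norm; lra.
  - by rewrite !ler0_norm; lra.
Qed.
Lemma grounded_string_continuum (l : R) A : grounded_string l A -> continuum A.
Proof.
move=> [g [cg _ _ ->]].
have := curve_continuum (s := 0) (t := 1) cg.
by rewrite (min_l ler01) (max_r ler01); apply; rewrite in_itv/= lexx ler01.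
Qed.

Lemma grounded_string_above (l : R) A z :
  grounded_string l A -> A z -> l <= z.2.
Proof.
move=> [g [_ g0 gl ->]] [t + <-]; rewrite /= in_itv/= => /andP[t0 t1].
move: t0; rewrite le_eqVlt => /orP[/eqP <-|t0]; first by rewrite g0.
by rewrite ltW// gl// in_itv/= t0.
Qed.

Lemma grounded_string_foot (l : R) A :
  grounded_string l A -> exists x, A (x, l).
Proof.
move=> [g [_ g0 _ ->]]; exists (g 0).1; exists 0.
  by rewrite /= in_itv/= lexx ler01.
by rewrite [LHS]surjective_pairing g0.
Qed.

Section poles.
Variables (l : R) (n : nat) (P : nat -> set plane) (x : nat -> R).
Hypothesis P_string : forall i, (i < n)%N -> grounded_string l (P i).
Hypothesis P_foot : forall i, (i < n)%N -> P i (x i, l).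
Hypothesis P_disjoint : forall i j, (i < j < n)%N -> P i `&` P j = set0.
Hypothesis x_lt : forall i j, (i < j < n)%N -> x i < x j.

(** Poles complete [K] and [L] to continua with alternating feet.  These meet,
    but not on the poles, which are disjoint from each other and from the
    continuum that they do not complete. *)
Lemma alternating_links_meet (i j k m : nat) K L :
  (i < j)%N -> (j < k)%N -> (k < m < n)%N ->
  continuum K -> continuum L ->
  (forall z, K z -> l <= z.2) -> (forall z, L z -> l <= z.2) ->
  P i `&` K !=set0 -> P k `&` K !=set0 ->
  P j `&` L !=set0 -> P m `&` L !=set0 ->
  P j `&` K = set0 -> P m `&` K = set0 ->
  P i `&` L = set0 -> P k `&` L = set0 ->
  K `&` L !=set0.
Proof.
move=> ij jk /andP[km mn] cK cL K_ge L_ge iK kK jL mL njK nmK niL nkL.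
have [i_n j_n k_n] : [/\ i < n, j < n & k < n]%N by split; lia.
have link a b M : (a < n)%N -> (b < n)%N -> continuum M ->
    P a `&` M !=set0 -> P b `&` M !=set0 -> continuum (P a `|` M `|` P b).
  move=> a_n b_n cM aM [z [bz Mz]].
  apply: continuumU; last exact: grounded_string_continuum (P_string b_n).
    by exists z; split=> //; right.
  by apply: continuumU => //; exact: grounded_string_continuum (P_string a_n).
have above a b M : (a < n)%N -> (b < n)%N -> (forall z, M z -> l <= z.2) ->
    forall z, (P a `|` M `|` P b) z -> l <= z.2.
  move=> a_n b_n M_ge z [[|/M_ge//]|];
    exact: grounded_string_above (P_string _).
have [kA cA] := link i k K i_n k_n cK iK kK.
have [kB cB] := link j m L j_n mn cL jL mL.
have [z [zA zB]] := alternating_continua_meet kA cA kB cB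
  (above i k K i_n k_n K_ge) (above j m L j_n mn L_ge)
  (or_introl (or_introl (P_foot i_n))) (or_intror (P_foot k_n))
  (or_introl (or_introl (P_foot j_n))) (or_intror (P_foot mn))
  (x_lt (i := i) (j := j) ltac:(lia)) (x_lt (i := j) (j := k) ltac:(lia))
  (x_lt (i := k) (j := m) ltac:(lia)).
have none (D E : set plane) : D `&` E = set0 -> D z -> E z -> False.
  by move=> DE Dz Ez; have : (D `&` E) z by []; rewrite DE.
have PP a b : (a < b < n)%N -> P a z -> P b z -> False.
  by move=> ab; apply: none; exact: P_disjoint.
case: zA => [[iz|Kz]|kz]; case: zB => [[jz|Lz]|mz].
- by case: (PP i j) => //; lia.
- by case: (none _ _ niL).
- by case: (PP i m) => //; lia.
- by case: (none _ _ njK).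
- by exists z.
- by case: (none _ _ nmK).
- by case: (PP j k) => //; lia.
- by case: (none _ _ nkL).
- by case: (PP k m) => //; lia.
Qed.

End poles.

(** Both in the part over the poles 0 to 3 and in the part over the poles 6 to 9
    the strings [u] and [v] are forced to cross, at their only common point [q].
    Cutting [u] at [q] must separate pole 0 from pole 2, and pole 6 from pole 8.
    Of the disjoint strings [w] and [w'], which both separate these two parts,
    one avoids [q]; it meets [u] at a single point, which then lies on the way
    to [q] from both 0 and 2, or from both 6 and 8: this is a link between
    two poles that avoids [q]. *)
Lemma no_alternating_strings (l : R) (P : nat -> set plane) (x : nat -> R)
    (u v w w' : set plane) (c d c' d' : nat) :
  (forall i, (i < 12)%N -> grounded_string l (P i)) ->
  (forall i, (i < 12)%N -> P i (x i, l)) ->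
  (forall i j, (i < j < 12)%N -> P i `&` P j = set0) ->
  (forall i j, (i < j < 12)%N -> x i < x j) ->
  grounded_string l u -> grounded_string l v ->
  grounded_string l w -> grounded_string l w' ->
  (forall i, (i < 12)%N -> P i `&` u !=set0 <-> i \in [:: 0; 2; 6; 8]%N) ->
  (forall i, (i < 12)%N -> P i `&` v !=set0 <-> i \in [:: 1; 3; 7; 9]%N) ->
  (forall i, (i < 12)%N -> P i `&` w !=set0 <-> i \in [:: c; d]) ->
  (forall i, (i < 12)%N -> P i `&` w' !=set0 <-> i \in [:: c'; d']) ->
  c \in [:: 4; 5]%N -> d \in [:: 10; 11]%N ->
  c' \in [:: 4; 5]%N -> d' \in [:: 10; 11]%N ->
  is_subset1 (u `&` v) -> is_subset1 (u `&` w) -> is_subset1 (u `&` w') ->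
  w `&` w' = set0 -> False.
Proof.
move=> Ps Pf Pd xl us vs ws ws' Pu Pv Pw Pw' c45 d1011 c45' d1011'.
move=> uv uw uw' ww'.
have links := alternating_links_meet Ps Pf Pd xl.
have hit A (s : seq nat) (i : nat) :
    (forall i, (i < 12)%N -> P i `&` A !=set0 <-> i \in s) ->
    (i < 12)%N -> i \in s -> P i `&` A !=set0.
  by move=> PA i12 /(PA _ i12).
have miss A (s : seq nat) (i : nat) B :
    (forall i, (i < 12)%N -> P i `&` A !=set0 <-> i \in s) ->
    B `<=` A -> (i < 12)%N -> i \notin s -> P i `&` B = set0.
  move=> PA BA i12 is_; apply: contrapT => /eqP/set0P[z [Piz Bz]].
  by move/negP: is_; apply; apply/(PA _ i12); exists z; split=> //; exact: BA.
have uge z : u z -> l <= z.2 by exact: grounded_string_above.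
have vge z : v z -> l <= z.2 by exact: grounded_string_above.
have cv := grounded_string_continuum vs.
have meet_v K i : continuum K -> K `<=` u -> i \in [:: 0; 6]%N ->
    P i `&` K !=set0 -> P i.+2 `&` K !=set0 -> K `&` v !=set0.
  move=> cK Ku i06 iK kK.
  have i9 : (i.+3 < 12)%N by case/or3P: i06 => // /eqP ->.
  apply: (links i i.+1 i.+2 i.+3) => //; first by rewrite ltnSn.
  - by move=> z /Ku/uge.
  - by apply: hit Pv _ _; [lia|case/or3P: i06 => // /eqP ->].
  - by apply: hit Pv _ _; [lia|case/or3P: i06 => // /eqP ->].
  - by apply: miss Pu Ku _ _; [lia|case/or3P: i06 => // /eqP ->].
  - by apply: miss Pu Ku _ _; [lia|case/or3P: i06 => // /eqP ->].
  - by apply: miss Pv _ _ _; [|lia|case/or3P: i06 => // /eqP ->].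
  - by apply: miss Pv _ _ _; [|lia|case/or3P: i06 => // /eqP ->].
have [q [uq vq]] : u `&` v !=set0.
  apply: (meet_v u 0%N) => //; first exact: grounded_string_continuum us.
    exact: hit Pu _ _.
  exact: hit Pu _ _.
have through_q K i : continuum K -> K `<=` u -> i \in [:: 0; 6]%N ->
    P i `&` K !=set0 -> P i.+2 `&` K !=set0 -> K q.
  move=> cK Ku i06 iK kK; have [z [Kz vz]] := meet_v K i cK Ku i06 iK kK.
  by rewrite -(uv z q)//; split=> //; exact: Ku.
wlog nwq : w w' c d c' d' ws ws' Pw Pw' c45 d1011 c45' d1011' uw uw' ww' /
    ~ w q.
  move=> H; have [wq|nwq] := pselect (w q); last exact: (H w w' c d c' d').
  apply: (H w' w c' d' c d) => //; first by rewrite setIC.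
  by move=> w'q; have : (w `&` w') q by []; rewrite ww'.
have /choice[a aP] (i : nat) :
    exists a, i \in [:: 0; 2; 6; 8]%N -> P i a /\ u a.
  have [i0268|_] := boolP (i \in _); last by exists q.
  have [|a [Pa ua]] := hit _ _ i Pu _ i0268; last by exists a.
  by move: i0268; rewrite !inE; lia.
have /choice[J JP] (i : nat) : exists J, i \in [:: 0; 2; 6; 8]%N ->
    [/\ continuum J, J `<=` u, J (a i), J q & forall z, J z -> z != q ->
      exists K, [/\ continuum K, K `<=` u, K (a i), K z & ~ K q]].
  have [i0268|_] := boolP (i \in _); last by exists u.
  have [_ uai] := aP i i0268.
  by have [J JP] := grounded_string_reaches us uai uq; exists J.
have hit_w i j : i \in [:: 0; 2]%N -> j \in [:: 6; 8]%N ->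
    exists z, w z /\ (J i z \/ J j z).
  move=> i02 j68.
  have i0268 : i \in [:: 0; 2; 6; 8]%N by move: i02; rewrite !inE; lia.
  have j0268 : j \in [:: 0; 2; 6; 8]%N by move: j68; rewrite !inE; lia.
  have [cJi Jiu Jia Jiq _] := JP i i0268.
  have [cJj Jju Jja Jjq _] := JP j j0268.
  have [Pia uai] := aP i i0268; have [Pja uaj] := aP j j0268.
  have Ju : J i `|` J j `<=` u by rewrite subUset.
  have /and4P[ic cj jd d12] : [&& i < c, c < j, j < d & d < 12]%N.
    by move: i02 j68 c45 d1011; rewrite !inE; clear; lia.
  have i_d := ltn_trans ic (ltn_trans cj jd).
  have /andP[cu du] :
      (c \notin [:: 0; 2; 6; 8]%N) && (d \notin [:: 0; 2; 6; 8]%N).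
    by move: c45 d1011; rewrite !inE => /orP[] /eqP -> /orP[] /eqP ->.
  have c12 : (c < 12)%N := ltn_trans cj (ltn_trans jd d12).
  suff [z [Jz wz]] : (J i `|` J j) `&` w !=set0 by exists z; split.
  apply: (links i c j d) => //.
  - by rewrite jd.
  - by apply: continuumU => //; exists q.
  - exact: grounded_string_continuum ws.
  - by move=> z /Ju/uge.
  - by move=> z; exact: grounded_string_above.
  - by exists (a i); split=> //; left.
  - by exists (a j); split=> //; right.
  - by apply: hit Pw c12 _; rewrite !inE eqxx.
  - by apply: hit Pw d12 _; rewrite !inE eqxx orbT.
  - exact: miss Pu Ju c12 cu.
  - exact: miss Pu Ju d12 du.
  - by apply: miss Pw _ (ltn_trans i_d d12) _; rewrite // !inE !ltn_eqF.
  - apply: miss Pw _ (ltn_trans jd d12) _; rewrite // !inE.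
    by rewrite (gtn_eqF cj) (ltn_eqF jd).
have [p [wp Jp]] := hit_w 0%N 6%N isT isT.
have in_u i z : i \in [:: 0; 2; 6; 8]%N -> J i z -> u z.
  by move=> /JP[_ Ju _ _ _]; exact: Ju.
have up : u p by case: Jp; exact: in_u.
have on_p i j : i \in [:: 0; 2]%N -> j \in [:: 6; 8]%N -> J i p \/ J j p.
  move=> i02 j68; have [z [wz Jz]] := hit_w i j i02 j68.
  rewrite (uw p z)//; split=> //; case: Jz; apply: in_u.
    by move: i02; rewrite !inE; lia.
  by move: j68; rewrite !inE; lia.
have pq : p != q by apply/eqP => pq; apply: nwq; rewrite -pq.
have both i : i \in [:: 0; 6]%N -> J i p -> J i.+2 p -> False.
  move=> i06 Jip Jkp.
  have i0268 : i \in [:: 0; 2; 6; 8]%N by move: i06; rewrite !inE; lia.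
  have k0268 : i.+2 \in [:: 0; 2; 6; 8]%N by move: i06; rewrite !inE; lia.
  have [_ _ _ _ /(_ p Jip pq)[K [cK Ku Ka Kp nKq]]] := JP i i0268.
  have [_ _ _ _ /(_ p Jkp pq)[L [cL Lu La Lp nLq]]] := JP i.+2 k0268.
  have : (K `|` L) q; last by case.
  apply: (through_q _ i) => //.
  - by apply: continuumU => //; exists p.
  - by rewrite subUset.
  - by exists (a i); split; [case: (aP i i0268)|left].
  - by exists (a i.+2); split; [case: (aP i.+2 k0268)|right].
have := both 0%N isT; have := both 6%N isT.
have := on_p 0%N 6%N isT isT; have := on_p 0%N 8%N isT isT.
have := on_p 2%N 6%N isT isT; have := on_p 2%N 8%N isT isT.
tauto.
Qed.
End strings.

(** * Polygons with corners in twelve blocks *)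

Section twelve_blocks.
Variable R : realType.
Local Notation vert := (4.-tuple 'I_12).

Let origin : R * R := (0, 0).
Let east : R * R := (1, 0).
Let east_unit : east.1 ^+ 2 + east.2 ^+ 2 = 1.
Proof. by rewrite /= expr1n expr0n addr0. Qed.

Let corner (t : R) : R * R := circle_pt origin east 1 t.

(** Block [i] contributes the parameters [2 i] and [2 i + 1], so that a single
    block is already enough for a polygon. *)
Definition corner_times (s : vert) : seq nat :=
  [seq k <- iota 0 24 | k./2 \in map val s].

Definition block_polygon (s : vert) : set (R * R) :=
  convex_hull (corner @` [set k%:R | k in [set` corner_times s]]).

Lemma mem_corner_times (s : vert) (i : 'I_12) (b : bool) :
  i \in s -> (b + i.*2)%N \in corner_times s.
Proof.
move=> si; rewrite mem_filter half_bit_double (map_f val si) mem_iota.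
by have := ltn_ord i; case: b; lia.
Qed.

Lemma corner_timesP (s : vert) (k : nat) : k \in corner_times s ->
  exists2 i : 'I_12, i \in s & (i.*2 <= k <= i.*2.+1)%N.
Proof.
rewrite mem_filter => /andP[/mapP[i si /= ki] _]; exists i => //; lia.
Qed.

Lemma block_polygon_disjoint (s t : vert) (a b : nat) : (a <= b)%N ->
  (forall i, i \in s -> (a <= i <= b)%N) ->
  (forall i, i \in t -> (i < a)%N || (b < i)%N) ->
  block_polygon s `&` block_polygon t = set0.
Proof.
move=> ab sab tab; apply/eqP/negPn/negP => /set0P.
apply: (@circle_arc_disjoint R origin east 1 ltr01 east_unit
  [set k%:R | k in [set` corner_times s]]
  [set k%:R | k in [set` corner_times t]] a.*2%:R b.*2.+1%:R).
- by rewrite ler_nat; lia.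
- move=> _ [k /corner_timesP[i /sab iab ki] <-].
  by rewrite /= in_itv/= !ler_nat; lia.
- rewrite -subset0 => x [[k /corner_timesP[i /tab iab ki] <-]].
  by rewrite /= in_itv/= !ler_nat; lia.
Qed.

Lemma block_polygon_share (s t : vert) (i : 'I_12) : i \in s -> i \in t ->
  block_polygon s `&` block_polygon t !=set0.
Proof.
move=> si ti; exists (corner (i.*2)%:R).
by split; apply: sub_convex_hull; exists (i.*2)%:R => //; exists i.*2 => //;
  exact: (mem_corner_times false).
Qed.

Lemma corner_inj : injective corner.
Proof.
move=> t t'; apply: contraPP => /eqP tt' E.
apply: (@circle_arc_disjoint R origin east 1 ltr01 east_unit
  [set t] [set t'] t t) => //.
- by move=> _ ->; rewrite /= in_itv/= lexx.
- rewrite -subset0 => _ [/= -> ]; rewrite in_itv/= => /le_anti.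
  by move=> E'; move: tt'; rewrite E' eqxx.
by exists (corner t); split; apply: sub_convex_hull; [exists t|exists t'].
Qed.

Lemma block_polygon_inscribed (s : vert) :
  inscribed_polygon origin 1 (block_polygon s).
Proof.
exists (map (fun k : nat => corner k%:R) (corner_times s)); split.
- rewrite map_inj_uniq ?filter_uniq ?iota_uniq// => k k' /corner_inj.
  by move/eqP; rewrite eqr_nat => /eqP.
- rewrite size_map.
  have s0 : thead s \in s by apply: mem_tnth.
  apply: (@uniq_leq_size _
    [:: (false + (thead s).*2)%N; (true + (thead s).*2)%N]).
    by rewrite /= inE; lia.
  by move=> k; rewrite !inE => /orP[] /eqP ->; apply: mem_corner_times.
- by move=> _ /mapP[k _ ->]; apply: circle_pt_circle.
congr convex_hull; apply/seteqP; split=> [_ [_ [k ks <-] <-]|_ /mapP[k ks ->]].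
  exact: (map_f (fun k : nat => corner k%:R)).
by exists k%:R => //; exists k.
Qed.

Definition block_graph_adj : rel vert :=
  fun s t => (s != t) && `[< block_polygon s `&` block_polygon t !=set0 >].

Lemma block_graph_sym : symmetric block_graph_adj.
Proof. by move=> s t; rewrite /block_graph_adj eq_sym setIC. Qed.

Lemma block_graph_irrefl : irreflexive block_graph_adj.
Proof. by move=> s; rewrite /block_graph_adj eqxx. Qed.

Definition block_graph : sgraph := SGraph block_graph_sym block_graph_irrefl.

Lemma block_graph_polygon_circle : polygon_circle_graph R block_graph.
Proof.
exists origin, 1, (block_polygon : block_graph -> set (R * R)).
split=> [|s|s t st]; [exact: ltr01|exact: block_polygon_inscribed|].
by rewrite /= /block_graph_adj st; split=> /asboolP.
Qed.

Definition pair_vert (i j : 'I_12) : vert := [tuple i; j; i; j].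

(** Of the three pairings of four points on a circle, only one crosses. *)
Lemma noncrossing_pairing (i j k m : 'I_12) : uniq [:: i; j; k; m] ->
  block_polygon (pair_vert i k) `&` block_polygon (pair_vert j m) = set0 \/
  block_polygon (pair_vert i m) `&` block_polygon (pair_vert j k) = set0.
Proof.
pose off (a b c : 'I_12) := ((c < minn a b) || (maxn a b < c))%N.
have outside (a b c d : 'I_12) : off a b c -> off a b d ->
    block_polygon (pair_vert a b) `&` block_polygon (pair_vert c d) = set0.
  rewrite /off => cab dab.
  apply: (block_polygon_disjoint (a := minn a b) (b := maxn a b)); first lia.
    by move=> z; rewrite !inE => /or4P[] /eqP ->; lia.
  by move=> z; rewrite !inE => /or4P[] /eqP ->.
rewrite /= !inE !negb_or -!val_eqE /= => U.
have : [|| off i k j && off i k m, off j m i && off j m k,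
           off i m j && off i m k | off j k i && off j k m].
  by rewrite /off; lia.
case/or4P=> /andP[h1 h2].
- by left; exact: outside.
- by left; rewrite setIC; exact: outside.
- by right; exact: outside.
- by right; rewrite setIC; exact: outside.
Qed.

(** The poles are numbered in the order of their feet.  As every choice of four
    blocks is a vertex, the polygons required in this order are available; only
    the last two, which have to be disjoint, depend on the position of the
    blocks on the circle. *)
Lemma block_graph_not_outer_1_string : ~ outer_1_string_graph R block_graph.
Proof.
move=> [l [F [Fs Fsimple FG]]].
have meet (s t : vert) : block_polygon s `&` block_polygon t !=set0 ->
    F s `&` F t !=set0.
  have [<- _|st st'] := eqVneq s t; last first.
    by apply/FG => //=; rewrite /block_graph_adj st; apply/asboolP.
  by have [x Fx] := grounded_string_foot (Fs s); exists (x, l).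
have disjoint (s t : vert) : block_polygon s `&` block_polygon t = set0 ->
    F s `&` F t = set0.
  move=> st0; apply/eqP/negPn/negP => /set0P; move: st0.
  have [<- st0 _|st st0] := eqVneq s t.
    have := block_polygon_share (mem_tnth ord0 s) (mem_tnth ord0 s).
    by rewrite st0 => -[].
  by move/(FG _ _ st)/andP => -[_ /asboolP]; rewrite st0 => -[].
pose pole i := pair_vert i i.
have pole_meets (i : 'I_12) (s : vert) :
    F (pole i) `&` F s !=set0 <-> i \in s.
  split=> [|si].
    2: by apply: meet; apply: block_polygon_share si; rewrite mem_head.
  apply: contraPT => si; rewrite disjoint; first by case.
  apply: (block_polygon_disjoint (leqnn i)) => j.
    by rewrite !inE !orbb => /eqP ->; rewrite leqnn.
  by move=> sj; rewrite -neq_ltn; apply: contraNneq si => /val_inj <-.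
have /choice[x xP] (i : 'I_12) : exists x, F (pole i) (x, l).
  exact: grounded_string_foot (Fs _).
have x_inj : injective x.
  move=> i j xij; have : i \in pole j.
    apply/pole_meets; exists (x i, l).
    by split; [exact: xP|rewrite xij; exact: xP].
  by rewrite !inE !orbb => /eqP.
pose leqx := fun i j => x i <= x j.
pose sigma k := nth ord0 (sort leqx (enum 'I_12)) k.
have size12 : size (sort leqx (enum 'I_12)) = 12%N.
  by rewrite size_sort size_enum_ord.
have sigma_eq k m : (k < 12)%N -> (m < 12)%N -> (sigma k == sigma m) = (k == m).
  by move=> k12 m12; rewrite nth_uniq ?size12// sort_uniq enum_uniq.
have sigma_lt k m : (k < m < 12)%N -> x (sigma k) < x (sigma m).
  move=> /andP[km m12]; have k12 := ltn_trans km m12.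
  rewrite lt_neqAle (inj_eq x_inj) sigma_eq// (ltn_eqF km) /=.
  apply: (@sorted_leq_nth _ leqx); rewrite ?inE ?size12//; last exact: ltnW.
  - by move=> j i h; exact: le_trans.
  - by move=> i; exact: lexx.
  - by apply: sort_sorted => i j; exact: le_total.
pose four a b c d : vert := [tuple sigma a; sigma b; sigma c; sigma d].
have four_meets a b c d k :
    (a < 12)%N -> (b < 12)%N -> (c < 12)%N -> (d < 12)%N ->
    (k < 12)%N -> F (pole (sigma k)) `&` F (four a b c d) !=set0 <->
                  k \in [:: a; b; c; d].
  move=> a12 b12 c12 d12 k12; rewrite pole_meets.
  by rewrite !inE !sigma_eq// orbF.
have pair_meets a b k : (a < 12)%N -> (b < 12)%N ->
    (k < 12)%N ->
    F (pole (sigma k)) `&` F (pair_vert (sigma a) (sigma b)) !=set0 <->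
    k \in [:: a; b].
  move=> a12 b12 k12; rewrite (four_meets a b a b)// !inE.
  by case: (k == a); case: (k == b).
have subset1 (s t : vert) k : sigma k \in s -> sigma k \notin t ->
    is_subset1 (F s `&` F t).
  by move=> sk tk; apply: Fsimple; apply: contraNneq tk => <-.
have abstract c d c' d' : c \in [:: 4; 5]%N -> d \in [:: 10; 11]%N ->
    c' \in [:: 4; 5]%N -> d' \in [:: 10; 11]%N ->
    block_polygon (pair_vert (sigma c) (sigma d)) `&`
    block_polygon (pair_vert (sigma c') (sigma d')) = set0 -> False.
  move=> c45 d1011 c45' d1011' /disjoint ww'.
  have [c12 c12'] : (c < 12)%N /\ (c' < 12)%N.
    by move: c45 c45'; rewrite !inE; lia.
  have [d12 d12'] : (d < 12)%N /\ (d' < 12)%N.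
    by move: d1011 d1011'; rewrite !inE; lia.
  apply: (no_alternating_strings (P := fun k => F (pole (sigma k)))
    (x := x \o sigma) (u := F (four 0 2 6 8)%N) (v := F (four 1 3 7 9)%N)
    (l := l) _ _ _ _ _ _ _ _ _ _ _ _ c45 d1011 c45' d1011' _ _ _ ww') => //.
  - move=> i j /andP[ij j12]; apply: contrapT => /eqP/set0P/pole_meets.
    by rewrite !inE !orbb sigma_eq ?ltn_eqF// (ltn_trans ij).
  - by move=> k; exact: four_meets.
  - by move=> k; exact: four_meets.
  - by move=> k; exact: pair_meets.
  - by move=> k; exact: pair_meets.
  - by apply: (subset1 _ _ 0%N); rewrite !inE !sigma_eq.
  - by apply: (subset1 _ _ 0%N); rewrite !inE !sigma_eq//;
      move: c45 d1011; rewrite !inE; lia.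
  - by apply: (subset1 _ _ 0%N); rewrite !inE !sigma_eq//;
      move: c45' d1011'; rewrite !inE; lia.
have := @noncrossing_pairing (sigma 4) (sigma 5) (sigma 10) (sigma 11).
by rewrite /= !inE !sigma_eq// => /(_ isT)[]; apply: abstract.
Qed.
End twelve_blocks.

(** * The four separations *)

Theorem theorem3 (R : realType) :
  (exists G : sgraph,
     interval_filament_graph R G /\ ~ polygon_circle_graph R G) /\
  (exists G : sgraph,
     grounded_L_graph R G /\ ~ interval_filament_graph R G) /\
  (exists G : sgraph,
     monotone_L_graph R G /\ ~ interval_filament_graph R G) /\
  (exists G : sgraph,
     polygon_circle_graph R G /\ ~ outer_1_string_graph R G).
Proof.
split.
  by exists prism; split;
    [exact: prism_filament|exact: prism_not_polygon_circle].
split.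
  by exists linked_squares; split;
    [exact: linked_squares_grounded|exact: linked_squares_not_filament].
split.
  by exists linked_squares; split;
    [exact: linked_squares_monotone|exact: linked_squares_not_filament].
exists (block_graph R); split; first exact: block_graph_polygon_circle.
exact: block_graph_not_outer_1_string.
Qed.
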